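(* Let $X=\{f\in C_0^\infty(\mathbb{R}^2\times\mathbb{S}^1) : f(\cdot,z)=f(\cdot,-z) \text{ for all } z\in\mathbb{S}^1\}$ and let $\mathcal{S}$ be the anisotropic spherical Radon transform $(\mathcal{S}f)(x,r)=\int_{\mathbb{S}^1}f(x+r\theta,\theta)\,d|\theta|$, $x\in\mathbb{R}^2$, $r>0$. Then the operator $\mathcal{S}:X\to R(\mathcal{S})$ (onto its range) has the null space $$\mathcal{N}(\mathcal{S})=\Big\{g\in X : (\mathcal{F}g)\Big(\xi,T(-\theta)\frac{\xi^\perp}{|\xi|}\Big)=-(\mathcal{F}g)\Big(\xi,T(\theta)\frac{\xi^\perp}{|\xi|}\Big)\ \text{for any } 0\le\theta\le\frac{\pi}{2}\ \text{and any } \xi\in\mathbb{R}^2\setminus\{0\}\Big\}.$$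
   Context: $\mathbb{S}^1$ is the unit circle in $\mathbb{R}^2$ and $d|\theta|$ its arc-length measure. $\mathcal{F}=\mathcal{F}_{x\to\xi}$ is the Fourier transform in the first variable $x\in\mathbb{R}^2$. For $\xi=(\xi_1,\xi_2)$, $\xi^\perp=(\xi_2,-\xi_1)$. $T(\theta):\mathbb{S}^1\to\mathbb{S}^1$ is the rotation by the angle $\theta$. *)

(* Defs.v *)
From HB Require Import structures.
From mathcomp Require Import all_boot all_order all_algebra.
From mathcomp Require Import all_classical all_reals all_analysis.
From mathcomp Require Import complex ring.
Set Implicit Arguments.
Unset Strict Implicit.
Unset Printing Implicit Defensive.
Import Order.TTheory GRing.Theory Num.Theory.
Import numFieldNormedType.Exports.
Local Open Scope classical_set_scope.
Local Open Scope complex_scope.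
Local Open Scope ring_scope.

(** Points of the unit circle; boolean equality makes the membership proof
    irrelevant, so two points are equal iff their coordinates are. *)
Definition circle (R : realType) : Type :=
  {z : R * R | z.1 ^+ 2 + z.2 ^+ 2 == 1}.

Section Circle.
Context {R : realType}.
Implicit Types (t a : R) (x y xi : R * R) (z : circle R).

Lemma circle_angle_subproof t :
  (cos t, sin t).1 ^+ 2 + (cos t, sin t).2 ^+ 2 == 1.
Proof. by rewrite /= cos2Dsin2. Qed.

Definition circle_angle t : circle R :=
  exist _ (cos t, sin t) (circle_angle_subproof t).

Lemma antipode_subproof z : (- sval z).1 ^+ 2 + (- sval z).2 ^+ 2 == 1.
Proof. by rewrite /= !sqrrN (svalP z). Qed.

Definition antipode z : circle R := exist _ (- sval z) (antipode_subproof z).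

(** Counterclockwise rotation of the plane by the angle [a]. *)
Definition plane_rotation a x : R * R :=
  (cos a * x.1 - sin a * x.2, sin a * x.1 + cos a * x.2).

Lemma rotation_subproof a z :
  (plane_rotation a (sval z)).1 ^+ 2 + (plane_rotation a (sval z)).2 ^+ 2 == 1.
Proof.
case: z => -[u v] /= /eqP uv; apply/eqP.
have -> : (cos a * u - sin a * v) ^+ 2 + (sin a * u + cos a * v) ^+ 2 =
    (cos a ^+ 2 + sin a ^+ 2) * (u ^+ 2 + v ^+ 2) by ring.
by rewrite cos2Dsin2 mul1r uv.
Qed.

Definition rotation a z : circle R :=
  exist _ (plane_rotation a (sval z)) (rotation_subproof a z).

Definition dot x y : R := x.1 * y.1 + x.2 * y.2.

(** The library norm on [R * R] is the sup norm, hence this one. *)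
Definition euclid_norm x : R := Num.sqrt (x.1 ^+ 2 + x.2 ^+ 2).

Definition perp xi : R * R := (xi.2, - xi.1).

Lemma perp_dir_subproof xi : xi != 0 ->
  let v := (euclid_norm xi)^-1 *: perp xi in v.1 ^+ 2 + v.2 ^+ 2 == 1.
Proof.
case: xi => u v uv0 /=.
have p0 : 0 < u ^+ 2 + v ^+ 2.
  rewrite lt_neqAle addr_ge0 ?sqr_ge0 // andbT eq_sym.
  by rewrite paddr_eq0 ?sqr_ge0 // !sqrf_eq0; exact: uv0.
rewrite /GRing.scale/= !exprMn sqrrN -mulrDr addrC exprVn sqr_sqrtr ?ltW //.
by rewrite mulVf // gt_eqF.
Qed.

(** [xi^perp / |xi|] as a point of the circle, for nonzero [xi]. *)
Definition perp_dir xi (xi0 : xi != 0) : circle R :=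
  exist _ ((euclid_norm xi)^-1 *: perp xi) (perp_dir_subproof xi0).

End Circle.

Section Smooth.
Context {R : realType}.

(** [n]-fold continuous differentiability: all iterated directional
    derivatives of order at most [n] exist and are continuous. *)
Fixpoint Cn {V : normedModType R} (n : nat) (f : V -> R) : Prop :=
  continuous f /\
  if n is n'.+1 then
    forall v : V, (forall x, derivable f x v) /\ Cn n' (fun x => 'D_v f x)
  else True.

Definition smooth {V : normedModType R} (f : V -> R) : Prop :=
  forall n, Cn n f.

(** Smoothness on [R^2 x S^1], read in the angular charts of the circle: local
    inverses of [t |-> (cos t, sin t)] form its smooth atlas. *)
Definition smooth_on_bundle (f : R * R -> circle R -> R[i]) : Prop :=
  smooth (fun p : (R * R) * R => complex.Re (f p.1 (circle_angle p.2))) /\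
  smooth (fun p : (R * R) * R => complex.Im (f p.1 (circle_angle p.2))).

(** Support as a subset of [R^2 x R^2]; as the circle is closed in [R^2], the
    closure taken here is the closure in [R^2 x S^1]. *)
Definition bundle_support (f : R * R -> circle R -> R[i]) :
    set ((R * R) * (R * R)) :=
  closure [set p | exists2 z : circle R, p.2 = sval z & f p.1 z != 0].

Definition test_function (f : R * R -> circle R -> R[i]) : Prop :=
  smooth_on_bundle f /\ compact (bundle_support f).

Definition even_test_functions : set (R * R -> circle R -> R[i]) :=
  [set f | test_function f /\ forall x z, f x z = f x (antipode z)].

End Smooth.

Section Transforms.
Context {R : realType}.

Definition cintegral d (T : measurableType d) (mu : {measure set T -> \bar R})
    (D : set T) (f : T -> R[i]) : R[i] :=
  Rintegral mu D (fun x => complex.Re (f x)) +i*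
  Rintegral mu D (fun x => complex.Im (f x)).

(** Integral over the circle against arc length, through the unit-speed
    parametrization. *)
Definition circle_integral (h : circle R -> R[i]) : R[i] :=
  cintegral lebesgue_measure `[0, 2 * pi] (fun t => h (circle_angle t)).

Definition spherical_radon (f : R * R -> circle R -> R[i]) (x : R * R) (r : R) :
    R[i] :=
  circle_integral (fun z => f (x + r *: sval z) z).

(** Fourier transform in the first variable, with kernel [exp (- i x . xi)] and
    no normalizing constant. *)
Definition fourier (f : R * R -> circle R -> R[i]) (xi : R * R)
    (z : circle R) : R[i] :=
  cintegral (lebesgue_measure \x lebesgue_measure)%E setT
    (fun x => (cos (dot x xi) -i* sin (dot x xi)) * f x z).

(** The functions [spherical_radon f] live on [R^2 x ]0, +oo[]. *)
Definition radon_null_space : set (R * R -> circle R -> R[i]) :=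
  [set f | even_test_functions f /\
           forall x r, 0 < r -> spherical_radon f x r = 0].

End Transforms.

(* Main.v *)
Require Import Defs.
From HB Require Import structures.
From mathcomp Require Import all_boot all_order all_algebra.
From mathcomp Require Import all_classical all_reals all_analysis.
From mathcomp Require Import complex measurable_realfun.
From mathcomp Require Import ring lra zify.
Import Order.TTheory GRing.Theory Num.Theory.
Import numFieldNormedType.Exports.
Local Open Scope classical_set_scope.
Local Open Scope complex_scope.
Local Open Scope ring_scope.

(** Let [e t = (cos t, sin t)] and split [g = A + i B].  For a real field [a]
    and a nonzero frequency [xi], integrate the circular mean
    [x |-> \int_0^(2 pi) a (x + r e t, t) dt] against [cos (x . xi + phi)].
    Fubini and the translation [x |-> x + r e t] turn the result into
    [\int_0^(2 pi) C (t) dt], where [C (t)] is the transform of the slice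
    [a (., t)] with the phase shifted by [- r e t . xi] ([slice_identity_phase]).
    Slice transforms have period [pi] because [a] is even on the circle, whereas
    [e t . xi] changes sign under [t |-> t + pi]; so the sine half of the shifted
    kernel integrates to zero ([slice_identity]).  Measuring angles from the
    direction of [xi^perp], where [e t . xi = |xi| sin th], and averaging over
    [th] and [- th] gives ([folded_slice_identity])
    [[
      2 F(mean)(xi) = \int_0^(2 pi) cos (r |xi| sin th) D (th) d th,
      D (th) = F a (xi, T(th) xi^perp / |xi|) + F a (xi, T(- th) xi^perp / |xi|).
    ]]
    If [D] vanishes, the Fourier transform of the mean vanishes off the origin,
    so the mean, continuous with compact support, vanishes
    ([plane_fourier_inj]).  If the means vanish, then [D] has a zero cosine
    transform in [sin th]; as [D] is even with period [pi], it is a function of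
    [|sin th|], and it vanishes ([arcsine_cosine_transform_inj]).

    Both injectivity statements are proved without inversion formulas.  Let [h]
    be the function to be killed, and suppose [h y > 0].  A trigonometric
    polynomial whose frequencies all belong to those where the transform of [h]
    is known to vanish is integrated to zero against [h]; taking for it a power
    of a function that is strictly largest at [y] (times a positive weight)
    makes the neighbourhood of [y] dominate, which is a contradiction
    ([peak_moments]).  The trigonometric polynomials are odd in each base
    cosine, so that only odd multiples of a base frequency occur and the zero
    frequency, about which nothing is known, is never needed.

    The condition on the complex transform of [g] mixes the transforms of [A]
    and [B]; used at [xi] and at [- xi] it separates them. *)

(** * Continuity of explicit functions *)

Section Continuity.
Context {R : realType} {X Y Z : topologicalType}.

Lemma cont_comp (f : X -> Y) (g : Y -> Z) :
  continuous f -> continuous g -> continuous (fun x => g (f x)).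
Proof. by move=> cf cg x; apply: (@continuous_comp _ _ _ f g); [exact: cf|exact: cg]. Qed.

Lemma cont_pair (f : X -> Y) (g : X -> Z) :
  continuous f -> continuous g -> continuous (fun x => (f x, g x)).
Proof. by move=> cf cg x U; apply: cvg_pair; [exact: cf|exact: cg]. Qed.

Lemma cont_fst (f : X -> Y * Z) : continuous f -> continuous (fun x => (f x).1).
Proof. by move=> cf x; apply: (@continuous_comp _ _ _ f fst); [exact: cf|exact: cvg_fst]. Qed.

Lemma cont_snd (f : X -> Y * Z) : continuous f -> continuous (fun x => (f x).2).
Proof. by move=> cf x; apply: (@continuous_comp _ _ _ f snd); [exact: cf|exact: cvg_snd]. Qed.

Lemma cont_cst (y : Y) : continuous (fun _ : X => y).
Proof. by move=> x; exact: cvg_cst. Qed.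

Lemma cont_id : continuous (fun x : X => x).
Proof. by move=> x; exact: cvg_id. Qed.

Implicit Types f g : X -> R.

Lemma cont_add f g : continuous f -> continuous g -> continuous (fun x => f x + g x).
Proof. by move=> cf cg x; apply: cvgD; [exact: cf|exact: cg]. Qed.

Lemma cont_opp f : continuous f -> continuous (fun x => - f x).
Proof. by move=> cf x; apply: cvgN; exact: cf. Qed.

Lemma cont_mul f g : continuous f -> continuous g -> continuous (fun x => f x * g x).
Proof. by move=> cf cg x; apply: cvgM; [exact: cf|exact: cg]. Qed.

Lemma cont_exp f n : continuous f -> continuous (fun x => f x ^+ n).
Proof.
move=> cf; elim: n => [|n IHn].
  by under eq_fun do rewrite expr0; move=> x; exact: cvg_cst.
by under eq_fun do rewrite exprS; exact: cont_mul.
Qed.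

Lemma cont_cos f : continuous f -> continuous (fun x => cos (f x)).
Proof.
by move=> cf x; apply: (@continuous_comp _ _ _ f cos); [exact: cf|exact: continuous_cos].
Qed.

Lemma cont_sin f : continuous f -> continuous (fun x => sin (f x)).
Proof.
by move=> cf x; apply: (@continuous_comp _ _ _ f sin); [exact: cf|exact: continuous_sin].
Qed.

End Continuity.

(** Dispatches on the head symbol of the body: trying the lemmas blindly would let
    unification unfold the numeric structures. *)
Ltac cont := repeat lazymatch goal with
  | |- continuous (fun _ => ?y) => exact: cont_cst
  | |- continuous (fun x => x) => exact: cont_id
  | |- continuous (fun _ => _ + _) => apply: cont_add
  | |- continuous (fun _ => - _) => apply: cont_opp
  | |- continuous (fun _ => _ * _) => apply: cont_mul
  | |- continuous (fun _ => _ ^+ _) => apply: cont_exp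
  | |- continuous (fun _ => cos _) => apply: cont_cos
  | |- continuous (fun _ => sin _) => apply: cont_sin
  | |- continuous (fun _ => (_, _)) => apply: cont_pair
  | |- continuous (fun _ => _.1) => apply: cont_fst
  | |- continuous (fun _ => _.2) => apply: cont_snd
  | |- continuous fst => exact: (cont_fst _ cont_id)
  | |- continuous snd => exact: (cont_snd _ cont_id)
  | |- continuous (@GRing.opp _) => exact: (cont_opp _ cont_id)
  | |- continuous cos => exact: continuous_cos
  | |- continuous sin => exact: continuous_sin
  | |- _ => assumption
  end.

(** * Borel measurability in the plane and in space *)

(** An open set is the countable union of the rational cubes that it contains,
    and a cube is a measurable rectangle. *)
Lemma open_measurable_plane_line {R : realType} (U : set (R * R * R)) :
  open U -> measurable U.
Proof.
move=> oU.
pose box (q : rat * rat * rat * rat) : set (R * R * R) :=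
  (ball (ratr q.1.1.1 : R) (ratr q.2 : R) `*` ball (ratr q.1.1.2 : R) (ratr q.2 : R))
  `*` ball (ratr q.1.2 : R) (ratr q.2 : R).
have mbox q : measurable (box q).
  by apply: measurableX; [apply: measurableX|]; apply: open_measurable; exact: ball_open.
have -> : U = \bigcup_q (if `[< box q `<=` U >] then box q else set0).
  apply/seteqP; split=> [[[x y] z] Ux|x [q _]]; last first.
    by case: asboolP => // + ?; apply.
  have := open_nbhs_nbhs (conj oU Ux).
  rewrite -nbhs_ballE => -[e /= e0 eU].
  have [r /andP[r0 re]] : exists r : rat, 0 < (ratr r : R) < e / 2.
    have /rat_in_itvoo[r] : 0 < e / 2 by rewrite divr_gt0.
    by rewrite in_itv /= => ?; exists r.
  have near_rat t : exists q : rat, `|(ratr q : R) - t| < ratr r.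
    have /rat_in_itvoo[q] : t - ratr r < t + ratr r by lra.
    by rewrite in_itv /= => qt; exists q; rewrite ltr_norml; lra.
  have [q1 q1x] := near_rat x; have [q2 q2y] := near_rat y.
  have [q3 q3z] := near_rat z.
  exists (q1, q2, q3, r) => //.
  case: asboolP => [_|]; first by [].
  case=> -[[x' y'] z'] [[/= h1 h2] h3]; apply: eU; rewrite /ball /=.
  move: h1 h2 h3; rewrite /ball /= => h1 h2 h3.
  move: q1x q2y q3z h1 h2 h3; rewrite !ltr_norml => q1x q2y q3z h1 h2 h3.
  by split=> /=; [split=> /=|]; rewrite /ball /= ltr_norml; lra.
apply: countable_bigcupT_measurable; first exact: countableP.
by move=> q; case: asboolP.
Qed.

Lemma continuous_measurable_plane_line {R : realType} (f : R * R * R -> R) :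
  continuous f -> measurable_fun setT f.
Proof.
move=> /continuousP cf; apply: (measurability _ (RGenOpens.measurableE R)).
move=> _ [_ [a [b ->] <-]]; rewrite setTI; apply: open_measurable_plane_line.
exact/cf/interval_open.
Qed.

Lemma continuous_measurable_plane {R : realType} (f : R * R -> R) :
  continuous f -> measurable_fun setT f.
Proof.
move=> cf; pose h (p : R * R * R) := f p.1.
have -> : f = h \o (fun x => (x, 0)) by [].
apply: measurableT_comp; last exact: pair2_measurable.
apply: continuous_measurable_plane_line => p.
by apply: continuous_comp; [exact: cvg_fst|exact: cf].
Qed.

(** * Integrals of bounded functions and Fubini on boxes *)

Lemma Rintegral_eq0 {R : realType} {d} {T : measurableType d}
    (mu : {measure set T -> \bar R}) (D : set T) (f : T -> R) :
  (forall x, D x -> f x = 0) -> \int[mu]_(x in D) f x = 0.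
Proof. by move=> f0; rewrite /Rintegral integral0_eq // => x Dx; rewrite f0. Qed.

Section Bounded.
Context {R : realType}.

Lemma compact_continuous_bounded {T : topologicalType} (K : set T) (f : T -> R) :
  compact K -> continuous f -> exists M, forall x, K x -> `|f x| <= M.
Proof.
move=> cK cf.
have /compact_bounded[M [_ MB]] : compact (f @` K).
  by apply: continuous_compact => //; exact: continuous_subspaceT.
by exists (M + 1) => x Kx; apply: (MB (M + 1)); [rewrite ltrDl|exists x].
Qed.

Context {d} {T : measurableType d} (mu : {measure set T -> \bar R}).

Lemma bounded_integrable (K : set T) (f : T -> R) M :
  measurable K -> (mu K < +oo)%E -> measurable_fun K f ->
  (forall x, K x -> `|f x| <= M) -> mu.-integrable K (EFin \o f).
Proof.
move=> mK Koo mf fM; apply: measurable_bounded_integrable => //.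
by exists M; split; [exact: num_real|move=> y My x Kx; exact: le_trans (fM _ Kx) (ltW My)].
Qed.

(** Over a set of finite measure, uniform closeness of the integrands suffices;
    the hypothesis is supplied by [near_compact_uniform]. *)
Lemma continuous_Rintegral {X : topologicalType} (K : set T) (F : X -> T -> R) x0 :
  measurable K -> (mu K < +oo)%E ->
  (forall x, mu.-integrable K (EFin \o F x)) ->
  (forall e, 0 < e -> \forall x \near x0, forall t, K t -> `|F x0 t - F x t| <= e) ->
  {for x0, continuous (fun x => \int[mu]_(t in K) F x t)}.
Proof.
move=> mK Koo intF unifF; apply/cvgrPdist_le => e e0.
pose d0 := e / (fine (mu K) + 1).
have mK0 : 0 < fine (mu K) + 1 by rewrite ltr_wpDl // fine_ge0.
have d00 : 0 < d0 by rewrite divr_gt0.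
move: (unifF _ d00); apply: filterS => x Fx.
rewrite -RintegralB //.
have intB : mu.-integrable K (EFin \o (fun t => F x0 t - F x t)).
  by have := integrableB mK (intF x0) (intF x); apply: eq_integrable.
apply: (le_trans (le_normr_Rintegral mK intB)).
apply: (@le_trans _ _ (\int[mu]_(t in K) d0)).
  apply: le_Rintegral => //.
  - by have := integrable_abse intB; apply: eq_integrable.
  - by apply: (@bounded_integrable _ _ d0) => // t _; rewrite ger0_norm // ltW.
rewrite Rintegral_cst // /d0 mulrAC ler_pdivrMr // ler_pM2l //.
by rewrite lerDl.
Qed.

End Bounded.

(** Tube lemma: compactness of [K] makes the continuity in [x] uniform in [t]. *)
Lemma near_compact_uniform {R : realType} {X T : topologicalType} (K : set T)
    (f : X * T -> R) (x0 : X) : compact K -> continuous f ->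
  forall e, 0 < e -> \forall x \near x0, forall t, K t -> `|f (x0, t) - f (x, t)| <= e.
Proof.
move=> cK cf e e0.
have /compact_near_coveringP cov := cK.
apply: (cov _ _ (fun x t => `|f (x0, t) - f (x, t)| <= e)) => t Kt.
have e20 : 0 < e / 2 by rewrite divr_gt0.
have /cvgrPdist_le /(_ _ e20) [[/= U V] [Ux Vt] UV] := cf (x0, t).
exists (V, U) => //= -[t' x] /= [Vt' Ux'].
have h1 := UV (x, t') (conj Ux' Vt').
have h2 := UV (x0, t') (conj (nbhs_singleton Ux) Vt').
have -> : f (x0, t') - f (x, t') =
   (f (x0, t) - f (x, t')) - (f (x0, t) - f (x0, t')) by ring.
by rewrite (splitr e) (le_trans (ler_normB _ _)) // lerD.
Qed.

Section Fubini_boxes.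
Context {R : realType} {d1 d2} {T1 : measurableType d1} {T2 : measurableType d2}.
Variables (m1 : {sigma_finite_measure set T1 -> \bar R})
  (m2 : {sigma_finite_measure set T2 -> \bar R}).
Variables (K1 : set T1) (K2 : set T2) (f : T1 * T2 -> R) (M : R).
Hypotheses (mK1 : measurable K1) (mK2 : measurable K2)
  (K1oo : (m1 K1 < +oo)%E) (K2oo : (m2 K2 < +oo)%E)
  (mf : measurable_fun setT f)
  (fM : forall x y, K1 x -> K2 y -> `|f (x, y)| <= M).

Let g := (EFin \o f) \_ (K1 `*` K2).

Let intg : (m1 \x m2)%E.-integrable setT g.
Proof.
have mK : measurable (K1 `*` K2) by exact: measurableX.
apply/(integrable_mkcond _ mK); apply: (@bounded_integrable _ _ _ _ _ _ M) => //.
- by rewrite /= product_measure1E // lte_mul_pinfty // ge0_fin_numE.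
- exact: measurable_funTS.
- by move=> [x y] [] /= ? ?; exact: fM.
Qed.

Let int1 x : K1 x -> m2.-integrable K2 (fun y => (f (x, y))%:E).
Proof.
move=> K1x; apply: (@bounded_integrable _ _ _ _ _ (fun y => f (x, y)) M) => //.
- by apply: measurable_funTS; apply: measurableT_comp => //; exact: pair1_measurable.
- by move=> y ?; exact: fM.
Qed.

Let int2 y : K2 y -> m1.-integrable K1 (fun x => (f (x, y))%:E).
Proof.
move=> K2y; apply: (@bounded_integrable _ _ _ _ _ (fun x => f (x, y)) M) => //.
- by apply: measurable_funTS; apply: measurableT_comp => //; exact: pair2_measurable.
- by move=> x ?; exact: fM.
Qed.

Let slice1 x : (\int[m2]_y g (x, y) =
  ((fun x => (\int[m2]_(y in K2) f (x, y))%:E) \_ K1) x)%E.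
Proof.
rewrite /patch; case: ifPn => [/set_mem K1x|K1x]; last first.
  rewrite integral0_eq // => y _; rewrite /g /patch ifF //.
  by apply/negbTE; move: K1x; apply: contra; rewrite !inE => -[].
rewrite /Rintegral fineK; last by apply: integrable_fin_num => //; exact: int1.
rewrite [RHS]integral_mkcond; apply: eq_integral => y _; rewrite /g /patch /=.
by rewrite in_setX /= (mem_set K1x).
Qed.

Let slice2 y : (\int[m1]_x g (x, y) =
  ((fun y => (\int[m1]_(x in K1) f (x, y))%:E) \_ K2) y)%E.
Proof.
rewrite /patch; case: ifPn => [/set_mem K2y|K2y]; last first.
  rewrite integral0_eq // => x _; rewrite /g /patch ifF //.
  by apply/negbTE; move: K2y; apply: contra; rewrite !inE => -[].
rewrite /Rintegral fineK; last by apply: integrable_fin_num => //; exact: int2.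
rewrite [RHS]integral_mkcond; apply: eq_integral => x _; rewrite /g /patch /=.
by rewrite in_setX /= (mem_set K2y) andbT.
Qed.

Lemma Rintegral_setX12 : \int[(m1 \x m2)%E]_(z in K1 `*` K2) f z =
  \int[m1]_(x in K1) \int[m2]_(y in K2) f (x, y).
Proof.
rewrite /Rintegral [in LHS]integral_mkcond -/g -(integral12_prod_meas1 intg).
rewrite [in RHS]integral_mkcond; congr fine; apply: eq_integral => x _.
exact: slice1.
Qed.

Lemma Rintegral_setX21 : \int[(m1 \x m2)%E]_(z in K1 `*` K2) f z =
  \int[m2]_(y in K2) \int[m1]_(x in K1) f (x, y).
Proof.
rewrite /Rintegral [in LHS]integral_mkcond -/g -(integral21_prod_meas1 intg).
rewrite [in RHS]integral_mkcond; congr fine; apply: eq_integral => y _.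
exact: slice2.
Qed.

Lemma Rintegral_swap : \int[m1]_(x in K1) \int[m2]_(y in K2) f (x, y) =
  \int[m2]_(y in K2) \int[m1]_(x in K1) f (x, y).
Proof. by rewrite -Rintegral_setX12 Rintegral_setX21. Qed.

End Fubini_boxes.

(** * Integrals on the line *)

Section Line.
Context {R : realType}.
Notation leb := (@lebesgue_measure R).
Implicit Types (G k : R -> R).

Lemma lebesgue_itv_ltoo (a b : R) : (leb `[a, b] < +oo)%E.
Proof. by rewrite lebesgue_measure_itv /=; case: ifP => _; rewrite ?ltry. Qed.

Lemma continuous_itv_integrable G a b :
  continuous G -> leb.-integrable `[a, b] (EFin \o G).
Proof.
move=> cG; apply: continuous_compact_integrable; first exact: segment_compact.
exact: continuous_subspaceT.
Qed.

Lemma Rintegral_itv_split G a b c : continuous G -> a <= b -> b <= c ->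
  \int[leb]_(t in `[a, c]) G t =
  \int[leb]_(t in `[a, b]) G t + \int[leb]_(t in `[b, c]) G t.
Proof.
move=> cG ab bc.
have intG := @continuous_itv_integrable G a c cG.
rewrite -(@Rintegral_itv_obnd_cbnd _ b); last first.
  apply: integrableS intG => // t /=; rewrite !in_itv /=; lra.
rewrite -(@Rintegral_itvB _ G (BLeft a) (BRight c) b) //.
by rewrite addrC subrK.
Qed.

Lemma Rintegral_itv_shift G a b h : continuous G -> a <= b ->
  \int[leb]_(t in `[a, b]) G (t + h) = \int[leb]_(t in `[a + h, b + h]) G t.
Proof.
move=> cG ab; rewrite /Rintegral; congr fine.
have D1 : derive1 (fun t : R => t + h) = cst 1.
  apply/funext => t; rewrite derive1E deriveD //.
  by rewrite derive_id derive_cst addr0.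
have cs : continuous (fun t : R => t + h).
  by move=> t; apply: cvgD; [exact: cvg_id|exact: cvg_cst].
rewrite (@integration_by_substitution_increasing R (fun t => t + h) G a b) //.
- by apply: eq_integral => t _; rewrite D1 /= mulr1.
- by move=> x y _ _; rewrite ltrD2r.
- by rewrite D1 => t _; exact: cvg_cst.
- by rewrite D1; exact: is_cvg_cst.
- by rewrite D1; exact: is_cvg_cst.
- split => //.
  + by apply: cvg_at_right_filter; exact: cs.
  + by apply: cvg_at_left_filter; exact: cs.
- exact: continuous_subspaceT.
Qed.

Lemma Rintegral_itv_opp G a b : continuous G -> a <= b ->
  \int[leb]_(t in `[a, b]) G (- t) = \int[leb]_(t in `[- b, - a]) G t.
Proof.
move=> cG ab; rewrite /Rintegral integration_by_substitution_oppr //.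
exact: continuous_subspaceT.
Qed.

Lemma continuous_translate G h : continuous G -> continuous (fun t => G (t + h)).
Proof.
by move=> cG; apply: (@cont_comp _ _ _ (fun t : R => t + h) G) => //; cont.
Qed.

Lemma continuous_reflect G h : continuous G -> continuous (fun t => G (- t + h)).
Proof.
by move=> cG; apply: (@cont_comp _ _ _ (fun t : R => - t + h) G) => //; cont.
Qed.

Lemma Rintegral_bounded_support G L : (forall t, L < `|t| -> G t = 0) ->
  forall a b, a <= - L -> L <= b ->
  \int[leb]_t G t = \int[leb]_(t in `[a, b]) G t.
Proof.
move=> G0 a b aL Lb; rewrite [RHS]Rintegral_mkcond; apply: eq_Rintegral => t _.
rewrite /patch; case: ifPn => //; rewrite notin_setE /= in_itv /= => abt.
by apply: G0; have [] := (ler_norm t, lerNnormlW (lexx `|t|)); case: (ltP L t); lra.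
Qed.

Lemma Rintegral_translate G L h : continuous G ->
  (forall t, L < `|t| -> G t = 0) ->
  \int[leb]_t G (t + h) = \int[leb]_t G t.
Proof.
move=> cG G0; have h0 := normr_ge0 h; have [hl hr] := (ler_norm h, lerNnormlW (lexx `|h|)).
pose A := `|L| + `|h|.
have Ll := ler_norm L; have L0 := normr_ge0 L.
rewrite (@Rintegral_bounded_support _ A _ (- A) A) //; last first.
  move=> t At; apply: G0; rewrite /A in At.
  have := ler_normB (t + h) h; rewrite addrK; lra.
rewrite Rintegral_itv_shift //; last by rewrite /A; lra.
by symmetry; apply: (@Rintegral_bounded_support _ L) => //; rewrite /A; lra.
Qed.

(** The part of the translated period that sticks out on the right is brought
    back to the left by one period. *)
Lemma Rintegral_period_translate k T h : continuous k -> 0 <= h <= T ->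
  (forall t, k (t + T) = k t) ->
  \int[leb]_(t in `[0, T]) k (t + h) = \int[leb]_(t in `[0, T]) k t.
Proof.
move=> ck /andP[h0 hT] kT; rewrite Rintegral_itv_shift ?add0r //; last by lra.
rewrite (@Rintegral_itv_split _ h T (T + h)) //; last by lra.
rewrite [RHS](@Rintegral_itv_split _ 0 h T) // addrC; congr (_ + _).
have := @Rintegral_itv_shift k 0 h T ck h0; rewrite add0r (addrC h) => <-.
by apply: eq_Rintegral => t _.
Qed.

Lemma Rintegral_period_opp k T : continuous k -> 0 <= T ->
  (forall t, k (t + T) = k t) ->
  \int[leb]_(t in `[0, T]) k (- t) = \int[leb]_(t in `[0, T]) k t.
Proof.
move=> ck T0 kT; rewrite Rintegral_itv_opp // oppr0.
have := @Rintegral_itv_shift k (- T) 0 T ck; rewrite addNr add0r => <-; last by lra.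
by apply: eq_Rintegral => t _.
Qed.

End Line.

(** * Integrals over the plane *)

Section Plane.
Context {R : realType}.
Notation leb := (@lebesgue_measure R).
Notation leb2 := (leb \x leb)%E.
Implicit Types (F : R * R -> R) (L : R).

Definition square L : set (R * R) := `[- L, L]%classic `*` `[- L, L]%classic.

Lemma squareP L x : square L x <-> `|x.1| <= L /\ `|x.2| <= L.
Proof.
by rewrite /square /setX /= !in_itv /= -!ler_norml.
Qed.

Lemma compact_square L : compact (square L).
Proof. by apply: compact_setX; exact: segment_compact. Qed.

Lemma measurable_square L : measurable (square L).
Proof. exact: measurableX. Qed.

Lemma square_ltoo L : (leb2 (square L) < +oo)%E.
Proof.
by rewrite /= product_measure1E // lte_mul_pinfty // ?lebesgue_itv_ltoo //
  ge0_fin_numE // lebesgue_itv_ltoo.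
Qed.

Lemma continuous_square_integrable F L :
  continuous F -> leb2.-integrable (square L) (EFin \o F).
Proof.
move=> cF; have [M FM] := compact_continuous_bounded _ _ (compact_square L) cF.
apply: (@bounded_integrable _ _ _ _ _ _ M) => //; first exact: measurable_square.
  exact: square_ltoo.
by apply: measurable_funTS; exact: continuous_measurable_plane.
Qed.

Lemma Rintegral_square_support F L : (forall x, ~ square L x -> F x = 0) ->
  \int[leb2]_x F x = \int[leb2]_(x in square L) F x.
Proof.
move=> F0; rewrite [RHS]Rintegral_mkcond; apply: eq_Rintegral => x _.
by rewrite /patch; case: ifPn => //; rewrite notin_setE => /F0.
Qed.

Lemma continuous_slice F x1 : continuous F -> continuous (fun x2 => F (x1, x2)).
Proof.
by move=> cF; apply: (@cont_comp _ _ _ (fun x2 : R => (x1, x2)) F) => //; cont.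
Qed.

Lemma Rintegral_plane_iterated F L : continuous F ->
  (forall x, ~ square L x -> F x = 0) ->
  \int[leb2]_x F x = \int[leb]_x1 \int[leb]_x2 F (x1, x2).
Proof.
move=> cF F0; rewrite (Rintegral_square_support _ _ F0).
have [M FM] := compact_continuous_bounded _ _ (compact_square L) cF.
transitivity (\int[leb]_(x1 in `[- L, L]) \int[leb]_(x2 in `[- L, L]) F (x1, x2)).
  apply: (@Rintegral_setX12 R _ _ _ _ leb leb _ _ F M) => //.
  - exact: lebesgue_itv_ltoo.
  - exact: lebesgue_itv_ltoo.
  - exact: continuous_measurable_plane.
  - by move=> x y hx hy; apply: FM.
transitivity (\int[leb]_(x1 in `[- L, L]) \int[leb]_x2 F (x1, x2)).
  apply: eq_Rintegral => x1 _; symmetry.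
  apply: Rintegral_bounded_support => // x2 Lx2.
  by apply: F0; rewrite squareP /= (leNgt `|x2|) Lx2 => -[].
symmetry; apply: Rintegral_bounded_support => // x1 Lx1.
apply: Rintegral_eq0 => x2 _.
by apply: F0; rewrite squareP /= (leNgt `|x1|) Lx1 => -[].
Qed.

Lemma continuous_translate_plane F (h : R * R) :
  continuous F -> continuous (fun x : R * R => F (x + h)).
Proof.
move=> cF x; apply: (@continuous_comp _ _ _ (fun x : R * R => x + h) F); last exact: cF.
by apply: (@cvgD _ (R * R)%type); [exact: cvg_id|exact: cvg_cst].
Qed.

(** Iterated integration reduces this to the translation on the line, applied
    first to the inner and then to the outer integral. *)
Lemma Rintegral_plane_translate F L (h : R * R) : continuous F ->
  (forall x, ~ square L x -> F x = 0) ->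
  \int[leb2]_x F (x + h) = \int[leb2]_x F x.
Proof.
case: h => h1 h2 cF F0.
pose A := L + `|h1| + `|h2|.
have FA x : ~ square A x -> F (x + (h1, h2)) = 0.
  move=> xA; apply: F0; apply: contra_not xA; rewrite !squareP /=.
  have h10 := normr_ge0 h1; have h20 := normr_ge0 h2.
  have := ler_normB (x.1 + h1) h1; have := ler_normB (x.2 + h2) h2.
  by rewrite !addrK /A => ? ? [? ?]; lra.
rewrite (Rintegral_plane_iterated _ _ (continuous_translate_plane _ _ cF) FA).
rewrite (Rintegral_plane_iterated _ _ cF F0).
have supp2 x1 x2 : L < `|x2| -> F (x1, x2) = 0.
  by move=> Lx; apply: F0; rewrite squareP /= (leNgt `|x2|) Lx => -[].
transitivity (\int[leb]_x1 \int[leb]_x2 F (x1 + h1, x2)).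
  apply: eq_Rintegral => x1 _.
  apply: (@Rintegral_translate _ (fun x2 => F (x1 + h1, x2)) L h2) => [|x2].
    exact: continuous_slice.
  exact: supp2.
apply: (@Rintegral_translate _ (fun x1 => \int[leb]_x2 F (x1, x2)) L h1).
  have -> : (fun x1 => \int[leb]_x2 F (x1, x2)) =
      (fun x1 => \int[leb]_(x2 in `[- L, L]) F (x1, x2)).
    by apply/funext => x1; apply: Rintegral_bounded_support => // x2; exact: supp2.
  move=> x1; apply: continuous_Rintegral => //.
  - exact: lebesgue_itv_ltoo.
  - by move=> y; apply: continuous_itv_integrable; exact: continuous_slice.
  - by apply: near_compact_uniform => //; exact: segment_compact.
move=> x1 Lx1; apply: Rintegral_eq0 => x2 _.
by apply: F0; rewrite squareP /= (leNgt `|x1|) Lx1 => -[].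
Qed.

(** The product measure again, under a name of its own that can carry the
    sigma-finiteness needed for integrating over the plane and a line. *)
Definition plane_measure := leb2.
HB.instance Definition _ := Measure.on plane_measure.

Lemma plane_measure_sigma_finite : sigma_finite setT plane_measure.
Proof.
exists (fun n => square n%:R).
  apply/seteqP; split=> // x _.
  exists (Num.truncn (Num.max `|x.1| `|x.2|)).+1 => //.
  apply/squareP.
  have := truncnS_gt (Num.max `|x.1| `|x.2|); rewrite gt_max => /andP[? ?].
  by split; exact: ltW.
move=> n; split; [exact: measurable_square|exact: square_ltoo].
Qed.

HB.instance Definition _ :=
  Measure_isSigmaFinite.Build _ _ _ plane_measure plane_measure_sigma_finite.

End Plane.

(** * Moments and peaks *)

Section Moments.
Context {R : realType} {d} {T : measurableType d} (mu : {measure set T -> \bar R}).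
Variables (K : set T).
Hypotheses (mK : measurable K) (Koo : (mu K < +oo)%E).

(** Multiplying by [cos (u x) ^+ 2] replaces the frequency [th + 2 j u] by a
    combination of itself and its two neighbours [th + 2 (j +- 1) u], which is
    again in the family of vanishing moments. *)
Lemma cos_power_moments (u th g : T -> R) (B : R) :
  measurable_fun K u -> measurable_fun K th -> measurable_fun K g ->
  (forall x, K x -> `|g x| <= B) ->
  (forall j : int, \int[mu]_(x in K) (cos (th x + 2 * j%:~R * u x) * g x) = 0) ->
  forall n (j : int),
  \int[mu]_(x in K) (cos (th x + 2 * j%:~R * u x) * (cos (u x) ^+ n.*2 * g x)) = 0.
Proof.
move=> mu_ mth mg gB h0; elim=> [|n IHn] j.
  by rewrite -[RHS](h0 j); apply: eq_Rintegral => x _; rewrite expr0 mul1r.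
pose I (j : int) x := cos (th x + 2 * j%:~R * u x) * (cos (u x) ^+ n.*2 * g x).
have mcos (f : T -> R) : measurable_fun K f -> measurable_fun K (fun x => cos (f x)).
  by move=> mf; apply: measurableT_comp => //; apply: continuous_measurable_fun;
    exact: continuous_cos.
have intI k : mu.-integrable K (EFin \o I k).
  apply: (@bounded_integrable _ _ _ _ _ _ B) => //.
    apply: measurable_funM; [apply: mcos; apply: measurable_funD => //|].
      by apply: measurable_funM => //; exact: measurable_cst.
    by apply: measurable_funM => //; apply: measurable_funX; exact: mcos.
  move=> x Kx; rewrite /I !normrM normrX.
  rewrite -[leRHS]mul1r ler_pM ?mulr_ge0 ?exprn_ge0 ?cos_max //.
  by rewrite -[leRHS]mul1r ler_pM ?exprn_ge0 ?exprn_ile1 ?cos_max ?gB.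
transitivity (\int[mu]_(x in K)
    (2^-1 * I j x + (4^-1 * I (j + 1) x + 4^-1 * I (j - 1) x))).
  apply: eq_Rintegral => x _; rewrite /I doubleS 2!exprS.
  set t := th x + 2 * j%:~R * u x.
  have -> : th x + 2 * (j + 1)%:~R * u x = t + (u x + u x).
    by rewrite /t intrD; ring.
  have -> : th x + 2 * (j - 1)%:~R * u x = t - (u x + u x).
    by rewrite /t intrB; ring.
  rewrite cosD cosB cosD.
  have -> : sin (u x) * sin (u x) = 1 - cos (u x) ^+ 2 by rewrite -expr2 sin2cos2.
  by field.
have intZ c k : mu.-integrable K (EFin \o (fun x => c * I k x)).
  by have := integrableZl mK c (intI k); apply: eq_integrable.
rewrite RintegralD //; last first.
  by have := integrableD mK (intZ 4^-1 (j + 1)) (intZ 4^-1 (j - 1)); apply: eq_integrable.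
by rewrite RintegralD // !RintegralZl // !IHn !mulr0 !addr0.
Qed.

(** On [V] the factor [p ^+ n] is at least [m' ^+ n], and where the weight [W]
    is negative it is at most [m ^+ n] with [m < m']: for large [n] the positive
    contribution of [V] exceeds all that the negative part can cancel. *)
Lemma peak_moments (p W : T -> R) (V : set T) (B m m' e : R) :
  measurable_fun K p -> measurable_fun K W ->
  (forall x, K x -> 0 <= p x <= 1) -> (forall x, K x -> `|W x| <= B) ->
  0 <= m < m' -> 0 < e ->
  measurable V -> V `<=` K -> (0 < mu V)%E ->
  (forall x, V x -> m' <= p x /\ e <= W x) ->
  (forall x, K x -> W x <= 0 -> p x <= m) ->
  ~ (forall n, \int[mu]_(x in K) (p x ^+ n * W x) = 0).
Proof.
move=> mp mW p01 WB /andP[m0 mm'] e0 mV VK V0 pV pW all0.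
have m'0 : 0 < m' := le_lt_trans m0 mm'.
have Voo : (mu V < +oo)%E by apply: le_lt_trans Koo; apply: le_measure; rewrite ?inE.
have fV0 : 0 < fine (mu V) by rewrite fine_gt0 // V0.
have key n : m' ^+ n * e * fine (mu V) <= m ^+ n * B * fine (mu K).
  have c0 : 0 <= m' ^+ n * e by rewrite mulr_ge0 ?exprn_ge0 // ltW.
  have int1 : mu.-integrable K (EFin \o (fun x => m' ^+ n * e * \1_V x)).
    apply: (@bounded_integrable _ _ _ _ _ _ (m' ^+ n * e)) => //.
      by apply: measurable_funM => //; apply: measurable_funTS; exact: measurable_indic.
    move=> x _; rewrite indicE ger0_norm; last by apply: mulr_ge0.
    by rewrite -[leRHS]mulr1 ler_wpM2l //; case: (x \in V).
  have int2 : mu.-integrable K (EFin \o (fun x => p x ^+ n * W x)).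
    apply: (@bounded_integrable _ _ _ _ _ _ B) => //.
      by apply: measurable_funM => //; exact: measurable_funX.
    move=> x Kx; have /andP[p0 p1] := p01 x Kx.
    rewrite normrM normrX -[leRHS]mul1r ler_pM ?exprn_ge0 ?WB //.
    by rewrite exprn_ile1 // ger0_norm.
  have int3 : mu.-integrable K (EFin \o (fun _ => m ^+ n * B)).
    by apply: (@bounded_integrable _ _ _ _ _ _ `|m ^+ n * B|).
  have : \int[mu]_(x in K) (m' ^+ n * e * \1_V x) <=
         \int[mu]_(x in K) (p x ^+ n * W x + m ^+ n * B).
    apply: le_Rintegral => //.
      by have := integrableD mK int2 int3; apply: eq_integrable.
    move=> x Kx; have /andP[p0 p1] := p01 x Kx.
    have B0 : 0 <= B := le_trans (normr_ge0 _) (WB x Kx).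
    have mB0 : 0 <= m ^+ n * B by rewrite mulr_ge0 ?exprn_ge0.
    rewrite indicE; case: (boolP (x \in V)) => [/set_mem Vx|_] /=.
      have [h1 h2] := pV x Vx.
      rewrite mulr1 ler_wpDr //; apply: ler_pM => //.
      - by rewrite exprn_ge0 // ltW.
      - exact: ltW.
      - by rewrite lerXn2r ?nnegrE // ltW.
    rewrite mulr0; case: (ltP 0 (W x)) => [W0|W0].
      by rewrite addr_ge0 // mulr_ge0 ?exprn_ge0 // ltW.
    rewrite -lerBlDr sub0r; apply: lerNnormlW; rewrite normrM normrX.
    apply: ler_pM => //; rewrite ?exprn_ge0 //; last exact: WB.
    by rewrite lerXn2r ?nnegrE // ger0_norm // pW.
  rewrite RintegralD // all0 add0r Rintegral_cst // RintegralZl //; last first.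
    apply: (@bounded_integrable _ _ _ _ _ _ 1) => //.
    by move=> x _; rewrite indicE; case: (x \in V); rewrite /= ?normr1 ?normr0.
  by rewrite {1}/Rintegral integral_indic // (setIidl VK).
(* The bound [key n] fails for large [n], since [(m / m') ^+ n] tends to zero. *)
pose q := m / m'.
have q01 : `|q| < 1 by rewrite ger0_norm ?divr_ge0 ?(ltW m'0) // ltr_pdivrMr // mul1r.
have /cvgrPdist_lt cq := cvg_expr q01.
pose C := `|B| * fine (mu K) + 1.
have C0 : 0 < C by rewrite ltr_wpDl // mulr_ge0 // fine_ge0.
have eV0 : 0 < e * fine (mu V) / C by rewrite divr_gt0 // mulr_gt0.
have [N _ /(_ N (leqnn N))] := cq _ eV0.
rewrite sub0r normrN ltr_pdivlMr // => qN.
have := key N; apply/negP; rewrite -ltNge.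
have -> : m ^+ N = m' ^+ N * q ^+ N by rewrite -exprMn /q mulrCA mulfV ?mulr1 // gt_eqF.
rewrite -!mulrA ltr_pM2l ?exprn_gt0 //; apply: le_lt_trans qN.
apply: (le_trans (ler_norm _)); rewrite normrM ler_wpM2l // normrM.
rewrite [X in _ * X]ger0_norm ?fine_ge0 // /C; lra.
Qed.

End Moments.

Lemma odd_int_neq0 {R : realType} (j : int) : 1 + 2 * j%:~R != 0 :> R.
Proof.
have -> : 1 + 2 * j%:~R = (1 + 2 * j)%:~R :> R by rewrite intrD intrM.
by rewrite intr_eq0; lia.
Qed.

(** Where [W <= 0], the function [p] attains its maximum by compactness, so a
    pointwise strict bound improves to a uniform one, as [peak_moments]
    requires. *)
Lemma compact_strict_gap {R : realType} {T : topologicalType} (K : set T)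
    (p W : T -> R) (c : R) : compact K -> continuous p -> continuous W -> 0 < c ->
  (forall x, K x -> W x <= 0 -> p x < c) ->
  exists2 m, 0 <= m < c & forall x, K x -> W x <= 0 -> p x <= m.
Proof.
move=> cK cp cW c0 pc.
pose K' := K `&` (W @^-1` [set y | y <= 0]).
have cK' : compact K'.
  apply: compact_closedI => //; apply: closed_comp; last exact: closed_le.
  by move=> x _; exact: cW.
have [K'0|K'0] := pselect (K' !=set0); last first.
  exists 0; first by rewrite lexx c0.
  by move=> x Kx Wx; exfalso; apply: K'0; exists x.
have [z /set_mem [Kz Wz] pz] := compact_EVT_max K'0 cK' (continuous_subspaceT cp).
exists (Num.max 0 (p z)); first by rewrite le_max lexx gt_max c0 pc.
move=> x Kx Wx; rewrite le_max; apply/orP; right; apply: pz.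
by rewrite inE.
Qed.

Section Linear_moments.
Context {R : realType} {d} {T : measurableType d} (mu : {measure set T -> \bar R}).
Variables (K : set T).
Hypotheses (mK : measurable K) (Koo : (mu K < +oo)%E).

(** Lets a quadratic polynomial in [c], such as one peaked at a prescribed value
    of [c], be raised to any power inside moments known for the powers of [c]. *)
Lemma quadratic_moments (c W : T -> R) (B al be ga : R) :
  measurable_fun K c -> measurable_fun K W ->
  (forall x, K x -> `|c x| <= 1) -> (forall x, K x -> `|W x| <= B) ->
  (forall k, \int[mu]_(x in K) (c x ^+ k * W x) = 0) ->
  forall n k, \int[mu]_(x in K)
    ((al + be * c x + ga * c x ^+ 2) ^+ n * (c x ^+ k * W x)) = 0.
Proof.
move=> mc mW c1 WB h0; elim=> [|n IHn] k.
  by rewrite -[RHS](h0 k); apply: eq_Rintegral => x _; rewrite expr0 mul1r.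
pose I k x := (al + be * c x + ga * c x ^+ 2) ^+ n * (c x ^+ k * W x).
have intI j : mu.-integrable K (EFin \o I j).
  apply: (@bounded_integrable _ _ _ _ _ _ ((`|al| + `|be| + `|ga|) ^+ n * B)) => //.
    apply: measurable_funM; last by apply: measurable_funM => //; exact: measurable_funX.
    apply: measurable_funX; apply: measurable_funD; first apply: measurable_funD => //.
      by apply: measurable_funM.
    by apply: measurable_funM => //; exact: measurable_funX.
  move=> x Kx; have cx := c1 x Kx; rewrite /I !normrM normrX.
  apply: ler_pM; rewrite ?exprn_ge0 ?mulr_ge0 //; last first.
    by rewrite -[leRHS]mul1r normrX; apply: ler_pM; rewrite ?exprn_ge0 ?exprn_ile1 ?WB.
  rewrite lerXn2r ?nnegrE ?addr_ge0 //.
  apply: (le_trans (ler_normD _ _)); apply: lerD; last first.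
    by rewrite normrM normrX ler_piMr ?exprn_ile1.
  apply: (le_trans (ler_normD _ _)); apply: lerD => //.
  by rewrite normrM ler_piMr.
have intZ a j : mu.-integrable K (EFin \o (fun x => a * I j x)).
  by have := integrableZl mK a (intI j); apply: eq_integrable.
transitivity (\int[mu]_(x in K) (al * I k x + (be * I k.+1 x + ga * I k.+2 x))).
  by apply: eq_Rintegral => x _; rewrite /I !exprS; ring.
rewrite RintegralD //; last first.
  by have := integrableD mK (intZ be k.+1) (intZ ga k.+2); apply: eq_integrable.
by rewrite RintegralD // !RintegralZl // !IHn !mulr0 !addr0.
Qed.

End Linear_moments.

(** * Injectivity of the cosine transform in sin *)

Section Cosine_transform.
Context {R : realType}.
Notation leb := (@lebesgue_measure R).
Implicit Types (D : R -> R).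

Lemma lebesgue_itv_gt0 (a b : R) : a < b -> (0 < leb `[a, b])%E.
Proof.
by move=> ab; rewrite lebesgue_measure_itv /= lte_fin ab -EFinD lte_fin subr_gt0.
Qed.

Lemma cos_unit_gt0 (x : R) : `|x| <= 1 -> 0 < cos x.
Proof.
move=> x1; rewrite -cos_norm; apply: (lt_le_trans (cos1_gt0 R)).
have pi2 : 2 <= pi :> R := pi_ge2 R.
case: (ltP `|x| 1) => [xl1|x1']; last by have -> : `|x| = 1 by apply/le_anti/andP.
by apply/ltW; rewrite ltr_cos ?in_itv /= ?normr_ge0 //=; lra.
Qed.

Lemma cos_sqr_unit_inj (x y : R) : `|x| <= 1 -> `|y| <= 1 ->
  cos x ^+ 2 = cos y ^+ 2 -> `|x| = `|y|.
Proof.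
move=> x1 y1 e; have pi2 : 2 <= pi :> R := pi_ge2 R.
apply: (@cos_inj R); rewrite ?in_itv /= ?normr_ge0 /=; [lra|lra|].
rewrite !cos_norm; apply/eqP; rewrite -(@eqrXn2 _ 2) ?e //; apply/ltW; exact: cos_unit_gt0.
Qed.

(** The symmetries of [D] are those of [|sin|], which takes each of its values
    once on the first quadrant; hence [D] is a function of [|sin|]. *)
Lemma fold_to_first_quadrant D a : 0 <= a <= 2 * pi ->
  (forall a, D (- a) = D a) -> (forall a, D (a + pi) = D a) ->
  exists b, [/\ 0 <= b <= pi / 2, D b = D a & sin b = `|sin a|].
Proof.
move=> /andP[a0 a2] De Dp.
have p0 := pi_gt0 R.
have Dm b : D (pi - b) = D b by rewrite addrC Dp.
have sm b : sin (pi - b) = sin b by rewrite addrC sinDpi sinN opprK.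
wlog api : a a0 a2 / a <= pi.
  move=> H; case: (leP a pi) => api; first exact: H.
  have [b [h1 h2 h3]] := H (a - pi) ltac:(lra) ltac:(lra) ltac:(lra).
  exists b; split=> //; first by rewrite h2 -Dp subrK.
  by rewrite h3 -[in RHS](subrK pi a) sinDpi normrN.
have s0 : 0 <= sin a by rewrite sin_ge0_pi // a0.
rewrite ger0_norm //; case: (leP a (pi / 2)) => a2'; first by exists a; split=> //; lra.
by exists (pi - a); split; [lra|rewrite Dm|rewrite sm].
Qed.

(** With [c = cos (sin a) ^+ 2], a strictly decreasing function of [|sin a|], the
    peak is [1 - (c - c a0) ^+ 2] and the weight is [cos (sin a) * D a].  The
    extra factor [cos (sin a)] is positive since [|sin a| <= 1]; it makes all
    frequencies odd integers, hence nonzero. *)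
Lemma arcsine_cosine_transform_le0 D : continuous D ->
  (forall a, D (- a) = D a) -> (forall a, D (a + pi) = D a) ->
  (forall s, 0 < s -> \int[leb]_(a in `[0, 2 * pi]) (cos (s * sin a) * D a) = 0) ->
  forall a, 0 <= a <= pi / 2 -> D a <= 0.
Proof.
move=> cD De Dp D0 a0 a0itv; have pi2 : 2 <= pi :> R := pi_ge2 R.
rewrite leNgt; apply/negP => Da0.
set K : set R := `[0, 2 * pi]%classic.
have cK : compact K by exact: segment_compact.
have mK : measurable K by exact: measurable_itv.
have [B DB] := compact_continuous_bounded K D cK cD.
pose c a : R := cos (sin a) ^+ 2.
pose W a : R := cos (sin a) * D a.
pose p a : R := 1 - (c a - c a0) ^+ 2.
have cc : continuous c by rewrite /c; cont.
have cW : continuous W by rewrite /W; cont.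
have cp : continuous p by rewrite /p; cont.
have Koo : (leb K < +oo)%E := lebesgue_itv_ltoo _ _.
have mf (f : R -> R) : continuous f -> measurable_fun K f.
  by move=> cf; apply: measurable_funTS; exact: continuous_measurable_fun.
have c01 a : 0 <= c a <= 1.
  rewrite /c sqr_ge0 /= -real_normK ?num_real // exprn_ile1 //; exact: cos_max.
have WB a : K a -> `|W a| <= B.
  by move=> Ka; rewrite normrM -[leRHS]mul1r ler_pM // ?cos_max ?DB.
have cWmom k : \int[leb]_(a in K) (c a ^+ k * W a) = 0.
  transitivity (\int[leb]_(a in K)
     (cos (sin a + 2 * 0%:~R * sin a) * (cos (sin a) ^+ k.*2 * D a))).
    apply: eq_Rintegral => a _; rewrite mulr0 mul0r addr0 /c /W -exprM mul2n; ring.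
  apply: (@cos_power_moments _ _ _ leb K mK Koo sin sin D B) => //;
    try by apply: mf => //; exact: continuous_sin.
  move=> j; rewrite -[RHS](D0 `|1 + 2 * j%:~R|); last first.
    by rewrite normr_gt0 odd_int_neq0.
  apply: eq_Rintegral => a _; congr (_ * _).
  rewrite -[in RHS](cos_norm (_ * sin a)) normrM normr_id -normrM cos_norm.
  by congr cos; ring.
have pmom n : \int[leb]_(a in K) (p a ^+ n * W a) = 0.
  have := @quadratic_moments _ _ _ leb K mK Koo c W B (1 - c a0 ^+ 2) (2 * c a0) (-1)
     (mf _ cc) (mf _ cW) _ WB cWmom n 0%N.
  move=> <- //; last by move=> a _; have := c01 a; case/andP=> ? ?; rewrite ger0_norm.
  apply: eq_Rintegral => a _; rewrite expr0 mul1r /p; congr (_ ^+ _ * _); ring.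
have pgap a : K a -> W a <= 0 -> p a < 1.
  rewrite /K /= in_itv /= => Ka Wa; rewrite /p ltrBlDr ltrDl exprn_even_gt0 //=.
  apply/negP; rewrite subr_eq0 => /eqP caa0.
  have saa0 : `|sin a| = `|sin a0|.
    by apply: cos_sqr_unit_inj; rewrite ?sin_max.
  have [b [bitv Db sb]] := fold_to_first_quadrant _ _ Ka De Dp.
  have ba0 : b = a0.
    apply: (@sin_inj R); rewrite ?in_itv /=; [lra|lra|].
    by rewrite sb saa0 ger0_norm // sin_ge0_pi //; lra.
  move: Wa; rewrite /W -Db ba0 pmulr_rle0 ?cos_unit_gt0 ?sin_max //.
  by rewrite leNgt Da0.
have [m /andP[m0 m1] mP] := compact_strict_gap _ _ _ _ cK cp cW ltr01 pgap.
pose m' := (m + 1) / 2.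
have Wa0 : 0 < W a0 by rewrite mulr_gt0 // cos_unit_gt0 ?sin_max.
have pa0 : p a0 = 1 by rewrite /p subrr expr0n subr0.
have nearV : \forall a \near a0, m' < p a /\ W a0 / 2 < W a.
  near=> a; split; near: a.
    by apply: (cvgr_gt _ (cp a0)); rewrite pa0 /m'; lra.
  by apply: (cvgr_gt _ (cW a0)); lra.
have /nbhs_ballP [e /= e0 eV] := nearV.
pose e' := Num.min (e / 2) 1.
have e'0 : 0 < e' by rewrite lt_min ltr01 divr_gt0.
have [e'1 e'2] : e' <= e / 2 /\ e' <= 1 by rewrite /e' !ge_min !lexx ?orbT.
apply: (@peak_moments _ _ _ leb K mK Koo p W `[a0, a0 + e']%classic B m m' (W a0 / 2)) => //.
- exact: mf.
- exact: mf.
- move=> a _; have h1 := c01 a; have h2 := c01 a0.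
  rewrite /p gerBl sqr_ge0 andbT subr_ge0 -real_normK ?num_real // exprn_ile1 //.
  by rewrite ler_norml; lra.
- by rewrite m0 /m'; lra.
- by rewrite divr_gt0.
- by move=> a; rewrite /K /= !in_itv /=; lra.
- by apply: lebesgue_itv_gt0; rewrite ltrDl.
- move=> a; rewrite /= in_itv /= => aV.
  have [] : m' < p a /\ W a0 / 2 < W a.
    by apply: eV; rewrite /ball /= ltr_norml; lra.
  by move=> /ltW ? /ltW ?.
Unshelve. all: by end_near. Qed.

Lemma arcsine_cosine_transform_inj D : continuous D ->
  (forall a, D (- a) = D a) -> (forall a, D (a + pi) = D a) ->
  (forall s, 0 < s -> \int[leb]_(a in `[0, 2 * pi]) (cos (s * sin a) * D a) = 0) ->
  forall a, 0 <= a <= pi / 2 -> D a = 0.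
Proof.
move=> cD De Dp D0 a a02; apply/le_anti/andP; split.
  exact: (arcsine_cosine_transform_le0 D).
rewrite -oppr_le0; apply: (arcsine_cosine_transform_le0 (fun a => - D a)) => //.
- by cont.
- by move=> b; rewrite De.
- by move=> b; rewrite Dp.
move=> s s0; transitivity (\int[leb]_(a in `[0, 2 * pi]) (-1 * (cos (s * sin a) * D a))).
  by apply: eq_Rintegral => b _; ring.
rewrite RintegralZl ?D0 ?mulr0 //; apply: continuous_itv_integrable.
by cont.
Qed.

End Cosine_transform.

(** * Injectivity of the Fourier transform in the plane *)

Section Plane_fourier.
Context {R : realType}.
Notation leb := (@lebesgue_measure R).
Notation leb2 := (leb \x leb)%E.
Implicit Types (G : R * R -> R) (L : R).

Lemma cos_sqr_eq1 (x : R) : `|x| <= 1 -> cos x ^+ 2 = 1 -> x = 0.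
Proof.
move=> x1 cx; apply/eqP; rewrite -normr_eq0; apply/eqP.
by rewrite -(normr0 R); apply: cos_sqr_unit_inj; rewrite ?normr0 // cos0 expr1n.
Qed.

(** The frequencies of the test function are [c * (j, k)] with [j] and [k] odd, and
    [c != 0]; none of them is zero.  The two cosine factors are brought in one
    after the other by [cos_power_moments]. *)
Lemma trigonometric_moments_plane G L c (y : R * R) : c != 0 -> continuous G ->
  (forall x, ~ square L x -> G x = 0) ->
  (forall xi phi, xi != 0 -> \int[leb2]_x (cos (dot x xi + phi) * G x) = 0) ->
  forall n, \int[leb2]_(x in square L)
    ((cos (c * (x.1 - y.1)) ^+ 2 * cos (c * (x.2 - y.2)) ^+ 2) ^+ n *
     (cos (c * (x.1 - y.1)) * cos (c * (x.2 - y.2)) * G x)) = 0.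
Proof.
move=> c0 cG G0 FG n.
have mK := @measurable_square R L.
have Koo := @square_ltoo R L.
have [B GB] := compact_continuous_bounded _ _ (compact_square L) cG.
pose u1 (x : R * R) : R := c * (x.1 - y.1).
pose u2 (x : R * R) : R := c * (x.2 - y.2).
have cu1 : continuous u1 by rewrite /u1; cont.
have cu2 : continuous u2 by rewrite /u2; cont.
have mf (f : R * R -> R) : continuous f -> measurable_fun (square L) f.
  by move=> cf; apply: measurable_funTS; exact: continuous_measurable_plane.
have base (s k : R) (j : int) : \int[leb2]_(x in square L)
    (cos (u1 x + s * u2 x + k * u2 x + 2 * j%:~R * u1 x) * G x) = 0.
  (* The first coordinate, an odd multiple of [c], keeps [xi] away from zero. *)
  pose xi : R * R := (c * (1 + 2 * j%:~R), c * (s + k)).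
  rewrite -[RHS](FG xi (- dot y xi)); last first.
    by rewrite /xi -pair_eqE negb_and /= mulf_neq0 ?odd_int_neq0.
  rewrite (Rintegral_square_support _ L); last by move=> x Lx; rewrite G0 ?mulr0.
  apply: eq_Rintegral => x _; congr (cos _ * _).
  by rewrite /u1 /u2 /dot /xi /=; ring.
pose g x := cos (u1 x) ^+ n.*2 * G x.
have cg : continuous g by rewrite /g; cont.
have gB x : square L x -> `|g x| <= B.
  move=> Lx; rewrite /g normrM normrX -[leRHS]mul1r ler_pM ?exprn_ge0 ?GB //.
  by rewrite exprn_ile1 ?cos_max.
have step1 (s k : R) : \int[leb2]_(x in square L)
    (cos (u1 x + s * u2 x + k * u2 x) * g x) = 0.
  pose th x := u1 x + s * u2 x + k * u2 x.
  have cth : continuous th by rewrite /th; cont.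
  have := cos_power_moments leb2 (square L) mK Koo u1 th G B
     (mf _ cu1) (mf _ cth) (mf _ cG) GB (base s k) n 0.
  move=> h; rewrite -[RHS]h; apply: eq_Rintegral => x _.
  by rewrite mulr0 mul0r addr0.
pose I (s : R) x := cos (u1 x + s * u2 x) * (cos (u2 x) ^+ n.*2 * g x).
have cI s : continuous (I s) by rewrite /I; cont.
have step2 (s : R) : \int[leb2]_(x in square L) I s x = 0.
  pose th x := u1 x + s * u2 x.
  have cth : continuous th by rewrite /th; cont.
  have := cos_power_moments leb2 (square L) mK Koo u2 th g B
     (mf _ cu2) (mf _ cth) (mf _ cg) gB (fun j => step1 s _) n 0.
  move=> h; rewrite -[RHS]h; apply: eq_Rintegral => x _.
  by rewrite mulr0 mul0r addr0.
transitivity (\int[leb2]_(x in square L) (2^-1 * (I 1 x + I (-1) x))).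
  apply: eq_Rintegral => x _; rewrite /I /g mul1r mulN1r cosD cosB -/(u1 x) -/(u2 x).
  rewrite exprMn -!exprM mul2n; by field.
have intI s := continuous_square_integrable (I s) L (cI s).
rewrite RintegralZl //; last first.
  by apply: continuous_square_integrable; cont.
by rewrite RintegralD // !step2 addr0 mulr0.
Qed.

(** The scale [c] is chosen so small that [c * (x.i - y.i)] has absolute value at
    most [1] on the square: there the cosines
    are positive, and both are equal to [1] only at [y]. *)
Lemma plane_fourier_le0 G L : continuous G ->
  (forall x, ~ square L x -> G x = 0) ->
  (forall xi phi, xi != 0 -> \int[leb2]_x (cos (dot x xi + phi) * G x) = 0) ->
  forall y, G y <= 0.
Proof.
move=> cG G0 FG y; rewrite leNgt; apply/negP => Gy0.
have Ly : square L y by apply: contrapT => /G0 e; rewrite e ltxx in Gy0.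
have L0 : 0 <= L by move/squareP: Ly => [+ _]; exact: le_trans.
(* The margin leaves room for a small square at [y] inside the larger one. *)
pose L' := L + 1.
have G0' x : ~ square L' x -> G x = 0.
  move=> Lx; apply: G0; apply: contra_not Lx; rewrite !squareP /L' => -[]; lra.
pose c := (2 * L')^-1.
have c0 : 0 < c by rewrite invr_gt0 /L'; lra.
have mom := trigonometric_moments_plane G L' c y (lt0r_neq0 c0) cG G0' FG.
pose u1 (x : R * R) : R := c * (x.1 - y.1).
pose u2 (x : R * R) : R := c * (x.2 - y.2).
have cu1 : continuous u1 by rewrite /u1; cont.
have cu2 : continuous u2 by rewrite /u2; cont.
pose W x := cos (u1 x) * cos (u2 x) * G x.
pose p x := cos (u1 x) ^+ 2 * cos (u2 x) ^+ 2.
have cW : continuous W by rewrite /W; cont.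
have cp : continuous p by rewrite /p; cont.
have mK := @measurable_square R L'.
have Koo := @square_ltoo R L'.
have cK := @compact_square R L'.
have [B WB] := compact_continuous_bounded _ _ cK cW.
have mf (f : R * R -> R) : continuous f -> measurable_fun (square L') f.
  by move=> cf; apply: measurable_funTS; exact: continuous_measurable_plane.
have u_le1 (s t : R) : `|s| <= L' -> `|t| <= L -> `|c * (s - t)| <= 1.
  move=> sL tL; rewrite normrM gtr0_norm // /c mulrC ler_pdivrMr ?mul1r; last by rewrite /L'; lra.
  apply: (le_trans (ler_normB _ _)); rewrite /L' in sL *; lra.
have [Ly1 Ly2] : `|y.1| <= L /\ `|y.2| <= L by apply/squareP.
have cos2_le1 t : cos t ^+ 2 <= 1 :> R.
  by rewrite -real_normK ?num_real // exprn_ile1 ?cos_max.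
have pgap x : square L' x -> W x <= 0 -> p x < 1.
  move=> /squareP[x1 x2] Wx.
  have h1 := u_le1 _ _ x1 Ly1; have h2 := u_le1 _ _ x2 Ly2.
  have p1 : p x <= 1 by rewrite /p -[leRHS]mul1r ler_pM ?sqr_ge0 ?cos2_le1.
  rewrite lt_neqAle p1 andbT; apply/negP => /eqP px.
  have e1 : cos (u1 x) ^+ 2 = 1.
    apply/le_anti; rewrite cos2_le1 /= -px /p -[leRHS]mulr1 ler_wpM2l ?sqr_ge0 //.
  have e2 : cos (u2 x) ^+ 2 = 1 by move: px; rewrite /p e1 mul1r.
  have xy : x = y.
    have /eqP := cos_sqr_eq1 _ h1 e1; have /eqP := cos_sqr_eq1 _ h2 e2.
    rewrite !mulf_eq0 !subr_eq0 (gt_eqF c0) /= => /eqP + /eqP.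
    by case: (x) (y) => ? ? [? ?] /= -> ->.
  move: Wx; rewrite /W xy /u1 /u2 !subrr !mulr0 cos0 !mul1r.
  by rewrite leNgt Gy0.
have [m /andP[m0 m1] mP] := compact_strict_gap _ _ _ _ cK cp cW ltr01 pgap.
pose m' := (m + 1) / 2.
have Wy : W y = G y by rewrite /W /u1 /u2 !subrr !mulr0 cos0 !mul1r.
have py : p y = 1 by rewrite /p /u1 /u2 !subrr !mulr0 cos0 !expr1n mul1r.
have nearV : \forall x \near y, m' < p x /\ G y / 2 < W x.
  near=> x; split; near: x.
    by apply: (cvgr_gt _ (cp y)); rewrite py /m'; lra.
  by apply: (cvgr_gt _ (cW y)); rewrite Wy; lra.
have /nbhs_ballP [e /= e0 eV] := nearV.
pose e' := Num.min (e / 2) 1.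
have e'0 : 0 < e' by rewrite lt_min ltr01 divr_gt0.
have [e'1 e'2] : e' <= e / 2 /\ e' <= 1 by rewrite /e' !ge_min !lexx ?orbT.
pose V : set (R * R) := `[y.1, y.1 + e']%classic `*` `[y.2, y.2 + e']%classic.
apply: (@peak_moments _ _ _ leb2 (square L') mK Koo p W V B m m' (G y / 2)) => //.
- exact: mf.
- exact: mf.
- by move=> x _; rewrite /p mulr_ge0 ?sqr_ge0 //= -[leRHS]mul1r ler_pM ?sqr_ge0 ?cos2_le1.
- by rewrite m0 /m'; lra.
- by rewrite divr_gt0.
- exact: measurableX.
- move=> x [] /=; rewrite squareP !in_itv /= /L' => h1 h2.
  by move: Ly1 Ly2; rewrite !ler_norml => ? ?; split; lra.
- rewrite /V /= product_measure1E // mule_gt0 //; apply: lebesgue_itv_gt0; lra.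
- move=> x [] /=; rewrite !in_itv /= => h1 h2.
  have [] : m' < p x /\ G y / 2 < W x.
    by apply: eV; split; rewrite /ball /= ltr_norml; lra.
  by move=> /ltW ? /ltW ?.
Unshelve. all: by end_near. Qed.

Lemma plane_fourier_inj G L : continuous G ->
  (forall x, ~ square L x -> G x = 0) ->
  (forall xi phi, xi != 0 -> \int[leb2]_x (cos (dot x xi + phi) * G x) = 0) ->
  forall y, G y = 0.
Proof.
move=> cG G0 FG y; apply/le_anti/andP; split; first exact: (plane_fourier_le0 G L).
rewrite -oppr_le0; apply: (plane_fourier_le0 (fun x => - G x) L) => //.
- by cont.
- by move=> x /G0 ->; rewrite oppr0.
move=> xi phi xi0; rewrite -[RHS](FG xi (phi + pi) xi0).
by apply: eq_Rintegral => x _; rewrite addrA cosDpi mulrN mulNr.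
Qed.

End Plane_fourier.

(** * The Fourier transform of a circular mean *)

Section Slice.
Context {R : realType}.
Notation leb := (@lebesgue_measure R).
Notation leb2 := (leb \x leb)%E.
Implicit Types (a : R * R -> R -> R) (x xi : R * R).

(** A function on the circle bundle that is even in the direction, read in the
    angle [t]: the antipode is the shift by [pi]. *)
Record even_field a (L : R) : Prop := EvenField {
  field_continuous : continuous (fun p : R * R * R => a p.1 p.2);
  field_support : forall x t, ~ square L x -> a x t = 0;
  field_pi : forall x t, a x (t + pi) = a x t }.

Definition circle_mean a x r : R :=
  \int[leb]_(t in `[0, 2 * pi]) a (x + r *: (cos t, sin t)) t.

(** The phase [phi] packs the two real Fourier transforms together: [0] gives the
    cosine transform of the slice and [- (pi / 2)] the sine transform. *)
Definition phase_fourier a xi phi t : R :=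
  \int[leb2]_x (cos (dot x xi + phi) * a x t).

(** The transform at the angles [t0 + th] and [t0 - th], summed: the quantity whose
    vanishing characterizes the null space. *)
Definition fold_fourier a xi phi t0 th : R :=
  phase_fourier a xi phi (t0 + th) + phase_fourier a xi phi (t0 - th).

Lemma cont_translated_field a L r : even_field a L ->
  continuous (fun p : R * R * R => a (p.1 + r *: (cos p.2, sin p.2)) p.2).
Proof.
move=> ha.
apply: (@cont_comp _ _ _
  (fun p : R * R * R => (p.1.1 + r * cos p.2, p.1.2 + r * sin p.2, p.2))
  (fun p => a p.1 p.2)); last exact: field_continuous ha.
by cont.
Qed.

Section Properties.
Context a L (ha : even_field a L).

Lemma field_slice_continuous t : continuous (fun x => a x t).
Proof.
apply: (@cont_comp _ _ _ (fun x : R * R => (x, t)) (fun p => a p.1 p.2)).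
  by cont.
exact: field_continuous ha.
Qed.

Lemma field_translate_support x r t :
  ~ square (L + `|r|) x -> a (x + r *: (cos t, sin t)) t = 0.
Proof.
move=> Lx; apply: (field_support _ _ ha); apply: contra_not Lx.
rewrite !squareP /= => -[h1 h2].
have hc : `|r * cos t| <= `|r| by rewrite normrM ler_piMr ?cos_max.
have hs : `|r * sin t| <= `|r| by rewrite normrM ler_piMr ?sin_max.
have := ler_normB (x.1 + r * cos t) (r * cos t).
have := ler_normB (x.2 + r * sin t) (r * sin t).
by rewrite !addrK => ? ?; split; lra.
Qed.

Lemma circle_mean_continuous r : continuous (fun x => circle_mean a x r).
Proof.
have cf := cont_translated_field a L r ha.
move=> x0; apply: continuous_Rintegral => //.
- exact: lebesgue_itv_ltoo.
- move=> x; apply: continuous_itv_integrable.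
  apply: (@cont_comp _ _ _ (fun t : R => (x, t))
    (fun p : R * R * R => a (p.1 + r *: (cos p.2, sin p.2)) p.2)) => //.
  by cont.
- apply: (near_compact_uniform _
    (fun p : R * R * R => a (p.1 + r *: (cos p.2, sin p.2)) p.2)) => //.
  exact: segment_compact.
Qed.

Lemma circle_mean_support x r : ~ square (L + `|r|) x -> circle_mean a x r = 0.
Proof. by move=> Lx; apply: Rintegral_eq0 => t _; exact: field_translate_support. Qed.

Lemma phase_fourier_continuous xi phi : continuous (phase_fourier a xi phi).
Proof.
have ca := field_continuous _ _ ha.
pose f (p : R * (R * R)) := cos (dot p.2 xi + phi) * a p.2 p.1.
have cf : continuous f.
  rewrite /f /dot; cont.
  by apply: (@cont_comp _ _ _ (fun p : R * (R * R) => (p.2, p.1))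
    (fun p : R * R * R => a p.1 p.2)) => //; cont.
have -> : phase_fourier a xi phi =
    fun t => \int[leb2]_(x in square L) f (t, x).
  apply/funext => t; apply: Rintegral_square_support => x Lx.
  by rewrite (field_support _ _ ha) ?mulr0.
move=> t; apply: continuous_Rintegral.
- exact: measurable_square.
- exact: square_ltoo.
- move=> s; apply: continuous_square_integrable.
  by apply: (@cont_comp _ _ _ (fun x : R * R => (s, x)) f) => //; cont.
- by apply: near_compact_uniform => //; exact: compact_square.
Qed.

Lemma phase_fourier_pi xi phi t :
  phase_fourier a xi phi (t + pi) = phase_fourier a xi phi t.
Proof. by apply: eq_Rintegral => x _; rewrite (field_pi _ _ ha). Qed.

Lemma phase_fourierE xi phi t : phase_fourier a xi phi t =
  cos phi * phase_fourier a xi 0 t - sin phi * phase_fourier a xi (- (pi / 2)) t.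
Proof.
have cat := field_slice_continuous t.
have int0 psi : leb2.-integrable (square L)
    (EFin \o (fun x => cos (dot x xi + psi) * a x t)).
  by apply: continuous_square_integrable; rewrite /dot; cont.
have intZ k psi : leb2.-integrable (square L)
    (EFin \o (fun x => k * (cos (dot x xi + psi) * a x t))).
  by apply: continuous_square_integrable; rewrite /dot; cont.
have supp psi : phase_fourier a xi psi t =
    \int[leb2]_(x in square L) (cos (dot x xi + psi) * a x t).
  apply: Rintegral_square_support => x Lx.
  by rewrite (field_support _ _ ha) ?mulr0.
have mK := @measurable_square R L.
rewrite !supp -!RintegralZl // -RintegralB //.
apply: eq_Rintegral => x _; rewrite addr0 cosBpihalf cosD; ring.
Qed.

(** Moving the translation [r e t] from the slice to the kernel only changes the
    phase. *)
Lemma translated_slice xi phi r t :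
  \int[leb2]_x (cos (dot x xi + phi) * a (x + r *: (cos t, sin t)) t) =
  phase_fourier a xi (phi - r * dot (cos t, sin t) xi) t.
Proof.
have cat := field_slice_continuous t.
pose e : R * R := (r * cos t, r * sin t).
pose F y := cos (dot y xi + (phi - r * dot (cos t, sin t) xi)) * a y t.
transitivity (\int[leb2]_x F (x + e)).
  by apply: eq_Rintegral => x _; congr (cos _ * _); rewrite /dot /=; ring.
apply: (@Rintegral_plane_translate _ F L e); first by rewrite /F /dot; cont.
by move=> x Lx; rewrite /F (field_support _ _ ha) ?mulr0.
Qed.

(** A projection-slice theorem for circular means: exchange the integrals over
    the plane and the circle, then translate each slice separately. *)
Lemma slice_identity_phase xi phi r :
  \int[leb2]_x (cos (dot x xi + phi) * circle_mean a x r) =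
  \int[leb]_(t in `[0, 2 * pi])
    phase_fourier a xi (phi - r * dot (cos t, sin t) xi) t.
Proof.
have cf := cont_translated_field a L r ha.
have caL := circle_mean_continuous r.
pose L' := L + `|r|.
pose f (p : R * R * R) := cos (dot p.1 xi + phi) * a (p.1 + r *: (cos p.2, sin p.2)) p.2.
have cf' : continuous f by rewrite /f /dot; cont.
rewrite (Rintegral_square_support _ L'); last first.
  by move=> x Lx; rewrite circle_mean_support ?mulr0.
transitivity (\int[leb2]_(x in square L') \int[leb]_(t in `[0, 2 * pi]) f (x, t)).
  apply: eq_Rintegral => x _; rewrite -RintegralZl //.
  apply: continuous_itv_integrable.
  apply: (@cont_comp _ _ _ (fun t : R => (x, t))
    (fun p : R * R * R => a (p.1 + r *: (cos p.2, sin p.2)) p.2)) => //.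
  by cont.
have cK : compact (square L' `*` `[0, 2 * pi]%classic : set (R * R * R)).
  by apply: compact_setX; [exact: compact_square|exact: segment_compact].
have [M fM] := compact_continuous_bounded _ _ cK cf'.
transitivity (\int[leb]_(t in `[0, 2 * pi]) \int[leb2]_(x in square L') f (x, t)).
  apply: (@Rintegral_swap R _ _ _ _ plane_measure leb _ _ f M) => //.
  - exact: measurable_square.
  - exact: square_ltoo.
  - exact: lebesgue_itv_ltoo.
  - exact: continuous_measurable_plane_line.
  - by move=> x t Lx Kt; apply: fM.
apply: eq_Rintegral => t _; rewrite -translated_slice; symmetry.
apply: Rintegral_square_support => x Lx.
by rewrite field_translate_support ?mulr0.
Qed.

End Properties.
End Slice.

(** * Folding at the direction orthogonal to the frequency *)

Section Folding.
Context {R : realType}.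
Notation leb := (@lebesgue_measure R).
Notation leb2 := (leb \x leb)%E.
Context (a : R * R -> R -> R) (L : R) (ha : even_field a L).
Implicit Types (x xi : R * R).

Lemma Rintegral_antiperiodic (k : R -> R) : continuous k ->
  (forall t, k (t + pi) = - k t) -> \int[leb]_(t in `[0, 2 * pi]) k t = 0.
Proof.
move=> ck kpi.
have k2pi t : k (t + 2 * pi) = k t.
  by rewrite (_ : t + 2 * pi = t + pi + pi) ?kpi ?opprK //; ring.
have pi_itv : 0 <= (pi : R) <= 2 * pi by have := pi_gt0 R; lra.
have := Rintegral_period_translate k (2 * pi) pi ck pi_itv k2pi.
have -> : \int[leb]_(t in `[0, 2 * pi]) k (t + pi) =
    \int[leb]_(t in `[0, 2 * pi]) (-1 * k t).
  by apply: eq_Rintegral => t _; rewrite kpi mulN1r.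
rewrite RintegralZl //; first by lra.
exact: continuous_itv_integrable.
Qed.

(** The shifted kernel splits as [cos e] times the transform at [phi] plus
    [sin e] times the transform at [phi - pi / 2], with [e = r e t . xi].  The
    second product changes sign under the half-turn [t |-> t + pi]. *)
Lemma slice_identity xi phi r :
  \int[leb2]_x (cos (dot x xi + phi) * circle_mean a x r) =
  \int[leb]_(t in `[0, 2 * pi])
    (cos (r * dot (cos t, sin t) xi) * phase_fourier a xi phi t).
Proof.
rewrite (slice_identity_phase a L ha).
pose e t := r * dot (cos t, sin t) xi.
have ce : continuous e by rewrite /e /dot /=; cont.
have cC psi := phase_fourier_continuous a L ha xi psi.
transitivity (\int[leb]_(t in `[0, 2 * pi])
   (cos (e t) * phase_fourier a xi phi t
    + sin (e t) * phase_fourier a xi (phi - pi / 2) t)).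
  apply: eq_Rintegral => t _.
  rewrite -/(e t) !(phase_fourierE a L ha xi (phi - _)) (phase_fourierE a L ha xi phi).
  by rewrite cosBpihalf sinBpihalf cosB sinB; ring.
have epi t : e (t + pi) = - e t by rewrite /e /dot /= cosDpi sinDpi; ring.
rewrite RintegralD //.
- rewrite (@Rintegral_antiperiodic (fun t => sin (e t) * phase_fourier a xi (phi - pi / 2) t)).
  + by rewrite addr0.
  + by cont.
  + by move=> t; rewrite epi (phase_fourier_pi a L ha) sinN mulNr.
- by apply: continuous_itv_integrable; cont.
- by apply: continuous_itv_integrable; cont.
Qed.

Lemma fold_fourier_continuous xi phi t0 : continuous (fold_fourier a xi phi t0).
Proof.
have cC := phase_fourier_continuous a L ha xi phi.
apply: cont_add.
  by apply: (@cont_comp _ _ _ (fun th => t0 + th) (phase_fourier a xi phi)) => //; cont.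
by apply: (@cont_comp _ _ _ (fun th => t0 - th) (phase_fourier a xi phi)) => //; cont.
Qed.

Lemma fold_fourier_opp xi phi t0 th :
  fold_fourier a xi phi t0 (- th) = fold_fourier a xi phi t0 th.
Proof. by rewrite /fold_fourier opprK addrC. Qed.

Lemma fold_fourier_pi xi phi t0 th :
  fold_fourier a xi phi t0 (th + pi) = fold_fourier a xi phi t0 th.
Proof.
rewrite /fold_fourier addrA (phase_fourier_pi a L ha); congr (_ + _).
by rewrite -[LHS](phase_fourier_pi a L ha); congr phase_fourier; ring.
Qed.

(** If [t0] is the angle of [xi^perp], then [e (t0 + th) . xi = N sin th] with
    [N = |xi|].  The sign of [th] disappears inside the cosine, so [th] and [- th] are
    integrated against the same kernel. *)
Lemma folded_slice_identity xi phi r N t0 : 0 <= t0 <= 2 * pi ->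
  xi.2 = N * cos t0 -> - xi.1 = N * sin t0 ->
  2 * \int[leb2]_x (cos (dot x xi + phi) * circle_mean a x r) =
  \int[leb]_(th in `[0, 2 * pi])
    (cos (r * N * sin th) * fold_fourier a xi phi t0 th).
Proof.
move=> t0itv x2 x1.
have cC := phase_fourier_continuous a L ha xi phi.
have cs : continuous (fun t => cos (r * N * sin t)) by cont.
pose k t := cos (r * dot (cos t, sin t) xi) * phase_fourier a xi phi t.
have ck : continuous k by rewrite /k /dot /=; cont.
have kpi t : k (t + pi) = k t.
  rewrite /k (phase_fourier_pi a L ha) /dot /= cosDpi sinDpi -[in RHS]cosN.
  by congr (cos _ * _); ring.
have k2pi t : k (t + 2 * pi) = k t.
  by rewrite (_ : t + 2 * pi = t + pi + pi) ?kpi //; ring.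
have x1' : xi.1 = - (N * sin t0) by rewrite -x1 opprK.
have kE th : k (th + t0) = cos (r * N * sin th) * phase_fourier a xi phi (t0 + th).
  rewrite /k (addrC th); congr (cos _ * _).
  rewrite /dot /= x1' x2 cosD sinD.
  have -> : (cos t0 * cos th - sin t0 * sin th) * - (N * sin t0) +
    (sin t0 * cos th + cos t0 * sin th) * (N * cos t0) =
    N * sin th * (cos t0 ^+ 2 + sin t0 ^+ 2) by ring.
  by rewrite cos2Dsin2; ring.
have kt0 : continuous (fun th => k (th + t0)) by exact: continuous_translate.
have kt0N : continuous (fun th => k (- th + t0)) by exact: continuous_reflect.
have e1 : \int[leb]_(th in `[0, 2 * pi]) k (th + t0) = \int[leb]_(th in `[0, 2 * pi]) k th.
  exact: Rintegral_period_translate.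
have e2 : \int[leb]_(th in `[0, 2 * pi]) k (- th + t0) = \int[leb]_(th in `[0, 2 * pi]) k th.
  apply: etrans e1.
  apply: (Rintegral_period_opp (fun th => k (th + t0)) (2 * pi) kt0).
    by have := pi_gt0 R; lra.
  by move=> t; rewrite -addrA (addrC _ t0) addrA k2pi.
rewrite slice_identity.
transitivity (\int[leb]_(th in `[0, 2 * pi]) k (th + t0) +
  \int[leb]_(th in `[0, 2 * pi]) k (- th + t0)).
  by rewrite e1 e2 mulr_natl mulr2n.
transitivity (\int[leb]_(th in `[0, 2 * pi]) (k (th + t0) + k (- th + t0))).
  symmetry; apply: RintegralD; first exact: measurable_itv.
  - exact: continuous_itv_integrable.
  - exact: continuous_itv_integrable.
by apply: eq_Rintegral => th _; rewrite !kE /fold_fourier sinN mulrN cosN; ring.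
Qed.

(** As [r] ranges over the positive reals, so does [r * N]: the fold has a zero
    cosine transform in [sin]. *)
Lemma circle_mean0_fold xi phi N t0 : 0 <= t0 <= 2 * pi -> 0 < N ->
  xi.2 = N * cos t0 -> - xi.1 = N * sin t0 ->
  (forall x r, 0 < r -> circle_mean a x r = 0) ->
  forall th, 0 <= th <= pi / 2 -> fold_fourier a xi phi t0 th = 0.
Proof.
move=> t0itv N0 x2 x1 m0; apply: arcsine_cosine_transform_inj.
- exact: fold_fourier_continuous.
- exact: fold_fourier_opp.
- exact: fold_fourier_pi.
move=> s s0; have sN : 0 < s / N by rewrite divr_gt0.
have := folded_slice_identity xi phi (s / N) N t0 t0itv x2 x1.
rewrite divfK ?gt_eqF // => <-; rewrite Rintegral_eq0 ?mulr0 // => x _.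
by rewrite m0 ?mulr0.
Qed.

(** The fold vanishes on the first quadrant, hence everywhere by its symmetries,
    and so does the Fourier transform of the mean away from the origin. *)
Lemma fold0_circle_mean :
  (forall xi phi N t0, 0 <= t0 <= 2 * pi -> 0 < N ->
     xi.2 = N * cos t0 -> - xi.1 = N * sin t0 ->
     forall th, 0 <= th <= pi / 2 -> fold_fourier a xi phi t0 th = 0) ->
  (forall xi : R * R, xi != 0 -> exists N t0,
     [/\ 0 <= t0 <= 2 * pi, 0 < N, xi.2 = N * cos t0 & - xi.1 = N * sin t0]) ->
  forall x r, circle_mean a x r = 0.
Proof.
move=> F0 polar x r; move: x.
apply: (plane_fourier_inj _ (L + `|r|)).
- exact: circle_mean_continuous ha r.
- by move=> x; exact: circle_mean_support ha x r.
move=> xi phi /polar[N [t0 [t0itv N0 x2 x1]]].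
suff : 2 * \int[leb2]_x (cos (dot x xi + phi) * circle_mean a x r) = 0 by lra.
rewrite (folded_slice_identity xi phi r N t0) //; apply: Rintegral_eq0 => th.
rewrite /= in_itv /= => thitv.
have [b [bitv <- _]] := fold_to_first_quadrant _ _ thitv
  (fold_fourier_opp xi phi t0) (fold_fourier_pi xi phi t0).
by rewrite (F0 xi phi N t0) ?mulr0.
Qed.

End Folding.

(** * Complex fields on the circle bundle *)

Section Circle_angles.
Context {R : realType}.
Implicit Types (z : circle R) (xi : R * R).

Lemma circle_angle_surj z : exists2 t, 0 <= t <= 2 * pi & z = circle_angle t.
Proof.
have pi0 := pi_gt0 R.
case: z => -[u v] uv; have /eqP uv1 := uv; rewrite /= in uv1.
have u1 : -1 <= u <= 1 by have := sqr_ge0 v; nra.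
have v2 : v ^+ 2 = 1 - u ^+ 2 by rewrite -uv1 addrAC subrr add0r.
have [a0 api] := (acos_ge0 u1, acos_lepi u1).
have ca : cos (acos u) = u by rewrite acosK // in_itv.
have sa : sin (acos u) = `|v| by rewrite sin_acos // -v2 sqrtr_sqr.
case: (leP 0 v) => v0.
  exists (acos u); first by lra.
  by apply: val_inj; rewrite /= ca sa ger0_norm.
exists (2 * pi - acos u); first by lra.
have -> : 2 * pi - acos u = - acos u + pi *+ 2 by rewrite mulr2n; ring.
by apply: val_inj; rewrite /= cosD2pi sinD2pi cosN sinN ca sa ltr0_norm // opprK.
Qed.

Lemma rotation_circle_angle a t :
  rotation a (circle_angle t) = circle_angle (t + a) :> circle R.
Proof.
apply: val_inj; rewrite /= /plane_rotation /= cosD sinD.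
by congr (_, _); ring.
Qed.

Lemma antipode_circle_angle t :
  antipode (circle_angle t) = circle_angle (t + pi) :> circle R.
Proof. by apply: val_inj; rewrite /= cosDpi sinDpi. Qed.

Lemma euclid_norm_gt0 xi : xi != 0 -> 0 < euclid_norm xi.
Proof.
case: xi => u v uv0; rewrite sqrtr_gt0 /= lt_neqAle addr_ge0 ?sqr_ge0 // andbT.
by rewrite eq_sym paddr_eq0 ?sqr_ge0 // !sqrf_eq0; exact: uv0.
Qed.

Lemma perp_dir_polar xi (xi0 : xi != 0) t : perp_dir xi0 = circle_angle t ->
  xi.2 = euclid_norm xi * cos t /\ - xi.1 = euclid_norm xi * sin t.
Proof.
move=> /(congr1 sval) [<- <-]; have N0 := euclid_norm_gt0 xi xi0.
by rewrite /GRing.scale /= !mulVKf ?gt_eqF.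
Qed.

Lemma perp_dir_opp xi (xi0 : xi != 0) (nxi0 : - xi != 0) t :
  perp_dir xi0 = circle_angle t -> perp_dir nxi0 = circle_angle (t + pi).
Proof.
rewrite -antipode_circle_angle => <-; apply: val_inj => /=.
by rewrite /euclid_norm /= !sqrrN /perp /= -scalerN.
Qed.

End Circle_angles.

Section Components.
Context {R : realType}.
Notation leb := (@lebesgue_measure R).
Notation leb2 := (leb \x leb)%E.
Implicit Types (f : R * R -> circle R -> R[i]) (xi : R * R) (a b : R * R -> R -> R).

Definition re_field f x t : R := complex.Re (f x (circle_angle t)).
Definition im_field f x t : R := complex.Im (f x (circle_angle t)).

(** The support is compact, so one square contains the supports of all slices; the
    antipodal symmetry becomes the period [pi] in the angle. *)
Lemma even_test_function_field f : even_test_functions f ->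
  exists L, even_field (re_field f) L /\ even_field (im_field f) L.
Proof.
move=> [[[/(_ 0%N)[cRe _] /(_ 0%N)[cIm _]] cS] ev].
have [M [_ MS]] := compact_bounded cS.
have supp x t : ~ square (M + 1) x -> f x (circle_angle t) = 0.
  move=> xM; apply/eqP; apply: contra_notT xM => fx0.
  have /= : `|(x, sval (circle_angle t))| <= M + 1.
    apply: (MS (M + 1)); first by rewrite ltrDl.
    by apply: subset_closure; exists (circle_angle t).
  rewrite prod_normE /= ge_max => /andP[+ _].
  by rewrite prod_normE /= ge_max squareP => /andP[].
have fpi x t : f x (circle_angle (t + pi)) = f x (circle_angle t).
  by rewrite -antipode_circle_angle -ev.
exists (M + 1); split; split => //.
- by move=> x t Lx; rewrite /re_field supp.
- by move=> x t; rewrite /re_field fpi.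
- by move=> x t Lx; rewrite /im_field supp.
- by move=> x t; rewrite /im_field fpi.
Qed.

Lemma spherical_radonE f x r : spherical_radon f x r =
  circle_mean (re_field f) x r +i* circle_mean (im_field f) x r.
Proof. by []. Qed.

Lemma phase_fourier_comb a b L xi t (s : R) : even_field a L -> even_field b L ->
  \int[leb2]_x (cos (dot x xi) * a x t + s * (sin (dot x xi) * b x t)) =
  phase_fourier a xi 0 t + s * phase_fourier b xi (- (pi / 2)) t.
Proof.
move=> ha hb.
have ca := field_slice_continuous _ _ ha t.
have cb := field_slice_continuous _ _ hb t.
rewrite /phase_fourier !(Rintegral_square_support _ L); first last.
- by move=> x Lx; rewrite (field_support _ _ ha) ?(field_support _ _ hb) ?mulr0 ?addr0.
- by move=> x Lx; rewrite (field_support _ _ ha) ?mulr0.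
- by move=> x Lx; rewrite (field_support _ _ hb) ?mulr0.
rewrite -RintegralZl; first last.
- by apply: continuous_square_integrable; rewrite /dot; cont.
- exact: measurable_square.
rewrite -RintegralD; first last.
- by apply: continuous_square_integrable; rewrite /dot; cont.
- by apply: continuous_square_integrable; rewrite /dot; cont.
- exact: measurable_square.
by apply: eq_Rintegral => x _; rewrite addr0 cosBpihalf.
Qed.

Lemma fourierE f L xi t : even_field (re_field f) L -> even_field (im_field f) L ->
  fourier f xi (circle_angle t) =
  (phase_fourier (re_field f) xi 0 t + phase_fourier (im_field f) xi (- (pi / 2)) t)
  +i* (phase_fourier (im_field f) xi 0 t - phase_fourier (re_field f) xi (- (pi / 2)) t).
Proof.
move=> hre him; rewrite /fourier /cintegral.
have := phase_fourier_comb _ _ L xi t 1 hre him; rewrite mul1r => <-.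
have := phase_fourier_comb _ _ L xi t (-1) him hre; rewrite mulN1r => <-.
congr (_ +i* _); apply: eq_Rintegral => x _;
  rewrite /re_field /im_field; case: (f x (circle_angle t)) => u v /=; ring.
Qed.

Lemma phase_fourier_cos_opp a xi t :
  phase_fourier a (- xi) 0 t = phase_fourier a xi 0 t.
Proof.
apply: eq_Rintegral => x _; rewrite !addr0 -cosN; congr (cos _ * _).
by rewrite /dot /=; ring.
Qed.

Lemma phase_fourier_sin_opp a L xi t : even_field a L ->
  phase_fourier a (- xi) (- (pi / 2)) t = - phase_fourier a xi (- (pi / 2)) t.
Proof.
move=> ha; rewrite -[RHS]addr0 -[RHS]addrC -[0](mul0r (phase_fourier a xi 0 t)).
transitivity (phase_fourier a xi (pi / 2) t).
  apply: eq_Rintegral => x _; rewrite -cosN; congr (cos _ * _).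
  by rewrite /dot /=; ring.
by rewrite (phase_fourierE a L ha) cos_pihalf sin_pihalf mul1r.
Qed.

(** The complex antisymmetry condition at one frequency amounts to two real
    equations, each of which mixes the real and the imaginary part of [f]. *)
Lemma fold_conditionP f L xi (xi0 : xi != 0) t th :
  even_field (re_field f) L -> even_field (im_field f) L ->
  perp_dir xi0 = circle_angle t ->
  let F := fun a phi => fold_fourier a xi phi t th in
  fourier f xi (rotation (- th) (perp_dir xi0)) =
    - fourier f xi (rotation th (perp_dir xi0)) <->
  F (re_field f) 0 + F (im_field f) (- (pi / 2)) = 0 /\
  F (im_field f) 0 - F (re_field f) (- (pi / 2)) = 0.
Proof.
move=> hre him ->; rewrite /= !rotation_circle_angle !(fourierE f L) // /fold_fourier.
split=> [[h1 h2]|[h1 h2]]; first by split; lra.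
apply/eqP; rewrite eq_complex /=; apply/andP; split; apply/eqP; lra.
Qed.

End Components.

Theorem theorem7p2 (R : realType) :
  @radon_null_space R =
  [set g : R * R -> circle R -> R[i] |
    even_test_functions g /\
    forall theta : R, 0 <= theta <= pi / 2 ->
    forall (xi : R * R) (xi0 : xi != 0),
      fourier g xi (rotation (- theta) (perp_dir xi0)) =
      - fourier g xi (rotation theta (perp_dir xi0))].
Proof.
apply/seteqP; split=> g [gX hg]; split=> //;
  have [L [hre him]] := even_test_function_field g gX.
  move=> th thitv xi xi0.
  have [t titv pt] := circle_angle_surj (perp_dir xi0).
  have [x2 x1] := perp_dir_polar xi xi0 t pt.
  have N0 := euclid_norm_gt0 xi xi0.
  have mean0 x r : 0 < r ->
      circle_mean (re_field g) x r = 0 /\ circle_mean (im_field g) x r = 0.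
    by move=> r0; have := hg x r r0; rewrite spherical_radonE => -[-> ->].
  have Fre phi : fold_fourier (re_field g) xi phi t th = 0.
    by apply: (circle_mean0_fold _ L hre xi phi _ t titv N0 x2 x1) => // x r /(mean0 x)[].
  have Fim phi : fold_fourier (im_field g) xi phi t th = 0.
    by apply: (circle_mean0_fold _ L him xi phi _ t titv N0 x2 x1) => // x r /(mean0 x)[].
  by apply/(fold_conditionP g L xi xi0 t th hre him pt); rewrite !Fre !Fim addr0 subr0.
have polar (xi : R * R) : xi != 0 -> exists N t0,
    [/\ 0 <= t0 <= 2 * pi, 0 < N, xi.2 = N * cos t0 & - xi.1 = N * sin t0].
  move=> xi0; have [t titv pt] := circle_angle_surj (perp_dir xi0).
  have [x2 x1] := perp_dir_polar xi xi0 t pt.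
  by exists (euclid_norm xi), t; split=> //; exact: euclid_norm_gt0.
have fold0 (xi : R * R) phi N t0 th : 0 < N -> xi.2 = N * cos t0 ->
    - xi.1 = N * sin t0 -> 0 <= th <= pi / 2 ->
    fold_fourier (re_field g) xi phi t0 th = 0 /\
    fold_fourier (im_field g) xi phi t0 th = 0.
  move=> N0 x2 x1 thitv.
  have Nxi : euclid_norm xi = N.
    rewrite /euclid_norm -sqrrN x1 x2 !exprMn -mulrDr addrC cos2Dsin2 mulr1.
    by rewrite sqrtr_sqr gtr0_norm.
  have xi0 : xi != 0.
    apply: contraTneq N0 => x0; rewrite -Nxi x0 /euclid_norm /= expr0n /= addr0.
    by rewrite sqrtr0 ltxx.
  (* The conditions at [xi] and [- xi] differ by the signs of the sine transforms. *)
  have nxi0 : - xi != 0 by rewrite oppr_eq0.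
  have pt : perp_dir xi0 = circle_angle t0.
    apply: val_inj; rewrite /= Nxi /perp x2 x1.
    by congr (_, _); rewrite /= -[LHS]/(_ * _) mulKf ?gt_eqF.
  have npt := perp_dir_opp xi xi0 nxi0 t0 pt.
  have /(fold_conditionP g L _ _ _ _ hre him pt) /= [e1 e2] := hg th thitv xi xi0.
  have /(fold_conditionP g L _ _ _ _ hre him npt) /= [] := hg th thitv (- xi) nxi0.
  have ar s : t0 + pi + s = t0 + s + pi by ring.
  rewrite /fold_fourier !ar.
  rewrite !(phase_fourier_pi _ _ hre) !(phase_fourier_pi _ _ him).
  rewrite !phase_fourier_cos_opp !(phase_fourier_sin_opp _ L _ _ hre).
  rewrite !(phase_fourier_sin_opp _ L _ _ him) => e3 e4.
  move: e1 e2; rewrite /fold_fourier => e1 e2.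
  have comb (c s p q p' q' : R) : p + p' = 0 -> q + q' = 0 ->
      c * p - s * q + (c * p' - s * q') = 0.
    move=> h1 h2; rewrite (_ : _ + _ = c * (p + p') - s * (q + q')); last by ring.
    by rewrite h1 h2 !mulr0 subr0.
  rewrite !(phase_fourierE _ L hre xi phi) !(phase_fourierE _ L him xi phi).
  by split; apply: comb; lra.
have mre := fold0_circle_mean (re_field g) L hre _ polar.
have mim := fold0_circle_mean (im_field g) L him _ polar.
move=> x r _; rewrite spherical_radonE mre ?mim //.
- by move=> xi phi N t0 _ N0 x2 x1 th /(fold0 xi phi N t0 th N0 x2 x1)[].
- by move=> xi phi N t0 _ N0 x2 x1 th /(fold0 xi phi N t0 th N0 x2 x1)[].
Qed.
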